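(* Let $A\in\mathscr R$ be a fixed set and let $\mathbf X,\mathbf X^{(1)},\mathbf X^{(2)},\ldots$ be independent, identically distributed random vectors in $[0,\infty)^d$ with common distribution $F\in\mathcal S_A$. Let $\{N_t,\,t\ge0\}$ be a Poisson process with intensity $\lambda>0$ and arrival times $0<\tau_1<\tau_2<\cdots$, and let $\{R_t,\,t\ge0\}$ be a real-valued stochastic process. Suppose that $\{\mathbf X,\mathbf X^{(1)},\mathbf X^{(2)},\ldots\}$, $\{N_t,\,t\ge0\}$ and $\{e^{R_t},\,t\ge0\}$ are mutually independent. Let $T>0$ be finite, and suppose there is a constant $C=C(T)<\infty$ such that $$\mathbf P\left[\inf_{0\le t\le T}R_t>-C\right]=1.$$ Put $\mathbf D(T)=\sum_{i=1}^{N_T}\mathbf X^{(i)}e^{-R_{\tau_i}}$. Then $$\mathbf P[\mathbf D(T)\in xA]\sim\lambda\int_0^T\mathbf P\left[\mathbf X\,e^{-R_t}\in xA\right]dt,\qquad x\to\infty.$$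
   Context: Fix an integer $d\ge 1$. $\mathscr R$ is the family of nonempty sets $A\subsetneq\mathbb R^d$ that are open, increasing (if $\mathbf x\in A$ and $\mathbf a\in[0,\infty)^d$ then $\mathbf x+\mathbf a\in A$), have convex complement $A^c$, and satisfy $\mathbf 0\notin\overline A$ (closure). For a random vector $\mathbf X$ in $[0,\infty)^d$ with distribution $F$ put $Y_A:=\sup\{u>0:\mathbf X\in uA\}$ (with $\sup\emptyset=0$), and let $F_A$ be the distribution of $Y_A$; its tail is $\overline F_A(x)=\mathbf P[Y_A>x]=\mathbf P[\mathbf X\in xA]$ for $x>0$. A distribution $V$ on $[0,\infty)$ with tail $\overline V=1-V$, $\overline V(x)>0$ for all $x\ge0$, belongs to $\mathcal S$ (subexponential) if $\lim_{x\to\infty}\overline{V^{n*}}(x)/\overline V(x)=n$ for every (equivalently, some) integer $n\ge2$, $V^{n*}$ being the $n$-fold convolution. $F\in\mathcal S_A$ means $F_A\in\mathcal S$. $N_t=\sup\{n\in\mathbb N:\tau_n\le t\}$ with $\sup\emptyset=0$; an empty sum of vectors is $\mathbf 0$. Here $\mathbf D(T)$ is the vector of discounted aggregate claims up to time $T$; the process $\{R_t\}$ is taken jointly measurable in $(t,\omega)$, so that the $R_{\tau_i}$ are random variables and the integral is defined. $f\sim g$ means $f(x)/g(x)\to1$ as $x\to\infty$.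
   Formalization: Joint measurability of R_t is required with respect to the process's own sigma-algebra augmented by null events; with mere joint measurability the claim fails, e.g. for R_t = -c at the arrival times and 0 elsewhere, which is independent of N and of the claims but gives R_{τ_i} = -c. *)

(* Defs.v *)
From HB Require Import structures.
From mathcomp Require Import all_boot all_order all_algebra finmap.
From mathcomp Require Import all_classical all_reals all_analysis.
From mathcomp Require Import measurable_realfun.

Set Implicit Arguments.
Unset Strict Implicit.
Unset Printing Implicit Defensive.

Import Order.TTheory GRing.Theory Num.Theory.
Import numFieldTopology.Exports numFieldNormedType.Exports.

Local Open Scope classical_set_scope.
Local Open Scope ring_scope.

Definition borel_rV (R : realType) (d : nat) : Type :=
  g_sigma_algebraType (@open 'rV[R]_d).

HB.instance Definition _ (R : realType) (d : nat) :=
  Measurable.on (borel_rV R d).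

Definition scale_set (R : realType) (d : nat) (u : R) (A : set 'rV[R]_d) :
  set 'rV[R]_d := [set u *: a | a in A].

Definition nneg_rV (R : realType) (d : nat) (x : 'rV[R]_d) : Prop :=
  forall j, 0 <= x ord0 j.

Record rare_set (R : realType) (d : nat) := RareSet {
  rare_set_val :> set 'rV[R]_d ;
  rare_set_neq0 : rare_set_val !=set0 ;
  rare_set_neqT : rare_set_val <> setT ;
  rare_set_open : open rare_set_val ;
  rare_set_increasing : forall x a,
    rare_set_val x -> nneg_rV a -> rare_set_val (x + a) ;
  rare_set_convexC :
    convex_set (~` rare_set_val : set (convex_lmodType 'rV[R]_d)) ;
  rare_set_closure : ~ closure rare_set_val 0 }.

(* Y_A as a function of the value of the random vector; [sup set0 = 0] in the
   library, and the set is bounded because 0 is not in the closure of A. *)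
Definition exit_level (R : realType) (d : nat) (A : rare_set R d)
    (x : borel_rV R d) : R :=
  sup [set u : R | 0 < u /\ scale_set u A x].

Section exit_level_measurable.
Context (R : realType) (d : nat) (A : rare_set R d).
Local Notation levels x := [set u : R | 0 < u /\ scale_set u A x].

Let scale_setE (u : R) (x : 'rV[R]_d) : 0 < u ->
  scale_set u A x <-> rare_set_val A (u^-1 *: x).
Proof.
move=> u0; split=> [[a Aa <-]|Ax]; first by rewrite scalerK// gt_eqF.
by exists (u^-1 *: x) => //; rewrite scalerKV// gt_eqF.
Qed.

Let levels_ubound (x : 'rV[R]_d) : has_ubound (levels x).
Proof.
have /existsNP [U] := @rare_set_closure _ _ A.
move=> /not_implyP[/nbhs_ballP[e /= e0 eU] UA].
exists (`|x| / e) => u [u0 /(scale_setE _ u0) Aux].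
rewrite ler_pdivlMr// leNgt; apply/negP => xue; apply: UA.
exists (u^-1 *: x); split => //; apply: eU.
rewrite -ball_normE /ball_ /= sub0r normrN normrZ gtr0_norm ?invr_gt0//.
by rewrite ltr_pdivrMl.
Qed.

Let exit_level_gtP (r : R) (x : 'rV[R]_d) : 0 <= r ->
  r < exit_level A x <-> exists u, [/\ r < u, 0 < u & scale_set u A x].
Proof.
move=> r0; split=> [rY|[u [ru u0 ux]]]; last first.
  by apply: (lt_le_trans ru); apply: ub_le_sup => //; exact: levels_ubound.
have : levels x !=set0.
  apply/set0P/eqP => Sx; move: rY; rewrite /exit_level Sx sup0.
  by rewrite ltNge r0.
by move=> /sup_gt /(_ rY)[u [u0 ux] ru]; exists u.
Qed.

Let exit_level_ge0 (x : 'rV[R]_d) : 0 <= exit_level A x.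
Proof.
rewrite /exit_level; have [->|/set0P[u [u0 ux]]] := eqVneq (levels x) set0.
  by rewrite sup0.
by apply: (le_trans (ltW u0)); apply: ub_le_sup => //; exact: levels_ubound.
Qed.

Lemma measurable_exit_level : measurable_fun setT (exit_level A).
Proof.
move=> mT; apply: (measurability _ (RGenOInfty.measurableE R)) => //.
move=> _ [_ [r ->] <-]; rewrite setTI.
have [r0|r0] := ltP r 0.
  rewrite (_ : _ @^-1` _ = setT) //; apply/seteqP; split => // x _ /=.
  by rewrite in_itv/= andbT (lt_le_trans r0) ?exit_level_ge0.
apply: sub_sigma_algebra.
rewrite (_ : _ @^-1` _ = \bigcup_(u in [set u | r < u])
    ((fun x : 'rV[R]_d => u^-1 *: x) @^-1` A)); last first.
  apply/seteqP; split=> x /=; rewrite in_itv/= andbT.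
    move=> /(exit_level_gtP _ r0)[u [ru u0 ux]].
    by exists u => //=; apply/scale_setE.
  move=> [u /= ru Aux]; apply/(exit_level_gtP _ r0); exists u.
  have u0 := le_lt_trans r0 ru.
  by split => //; apply/scale_setE.
apply: bigcup_open => u _; apply: open_comp; last exact: rare_set_open.
by move=> x _; exact: scaler_continuous.
Qed.

HB.instance Definition _ :=
  isMeasurableFun.Build _ _ _ _ (exit_level A) measurable_exit_level.

End exit_level_measurable.

Definition addp (R : realType) (p : R * R) : R := p.1 + p.2.

Lemma measurable_addp (R : realType) : measurable_fun setT (@addp R).
Proof. exact: measurable_funD. Qed.

HB.instance Definition _ (R : realType) :=
  isMeasurableFun.Build _ _ _ _ (@addp R) (@measurable_addp R).

Definition convolution (R : realType) (V W : probability R R) :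
  probability R R := distribution (V \x W)%E (@addp R).

Fixpoint convolution_pow (R : realType) (V : probability R R) (n : nat) :
    probability R R :=
  if n is n'.+1 then convolution V (convolution_pow V n') else \d_(0 : R).

Definition tail (R : realType) (V : probability R R) (x : R) : R :=
  fine (V `]x, +oo[%classic).

Definition subexponential (R : realType) (V : probability R R) : Prop :=
  [/\ V `]-oo, 0[%classic = 0%E,
      forall x, 0 <= x -> 0 < tail V x &
      forall n, (2 <= n)%N ->
        (fun x => tail (convolution_pow V n) x / tail V x) @ +oo --> (n%:R : R)].

Definition subexponential_on (R : realType) (d : nat) (A : rare_set R d)
    (F : probability (borel_rV R d) R) : Prop :=
  subexponential (distribution F (exit_level A)).

(* Meant for sigma-algebras [G i]. *)
Definition mutual_independence (disp : measure_display)
    (T : measurableType disp) (R : realType) (P : probability T R)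
    (I : choiceType) (G : I -> set (set T)) : Prop :=
  forall (J : {fset I}) (E : I -> set T), (forall i, i \in J -> G i (E i)) ->
    P (\bigcap_(i in [set` J]) E i) = (\prod_(i <- J) P (E i))%E.

Definition process_sigma (T : pointedType) (disp : measure_display)
    (T' : measurableType disp) (I : Type) (D : set I) (X : I -> T -> T') :
    set (set T) :=
  <<s \bigcup_(i in D) g_sigma_algebra_preimage (X i) >>.

Definition null_augmentation (disp : measure_display)
    (T : measurableType disp) (R : realType) (P : probability T R)
    (G : set (set T)) : set (set T) :=
  <<s G `|` [set E | measurable E /\ P E = 0%E] >>.

(* Measurability in (t, w) is required with respect to the (augmented)
   sigma-algebra of the process itself.  Measurability with respect to the
   ambient sigma-algebra would be too weak: the process that is 1 at the jump
   times of a Poisson process N and 0 elsewhere would then qualify, and it is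
   independent of N in the sense of the sigma-algebras generated by the
   coordinates, since each coordinate is almost surely 0. *)
Definition jointly_measurable (disp : measure_display)
    (T : measurableType disp) (R : realType) (P : probability T R)
    (Z : R -> T -> R) : Prop :=
  let G := null_augmentation P (process_sigma `[0, +oo[%classic Z) in
  measurable_fun [set p : R * g_sigma_algebraType G | 0 <= p.1]
    (fun p => Z p.1 p.2).

Definition poisson_process (disp : measure_display)
    (T : measurableType disp) (R : realType) (P : probability T R)
    (lambda : R) (N : R -> {RV P >-> nat}) : Prop :=
  [/\ forall w, N 0 w = 0%N,
      forall s t k, 0 <= s -> s < t ->
        P [set w | N t w = (N s w + k)%N] =
        (poisson_pmf (lambda * (t - s)) k)%:E &
      forall t : nat -> R, 0 <= t 0%N -> nondecreasing_seq t ->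
        mutual_independence P (fun i : nat => g_sigma_algebra_preimage
          (fun w => (N (t i.+1) w)%:R - (N (t i) w)%:R : R))].

(* The arrival times are [tau 1], [tau 2], ...; [tau 0] is not used.  The
   supremum is taken in the extended reals, so that it is finite; adjoining 0
   encodes sup(empty set) = 0. *)
Definition arrival_times (T : Type) (R : realType) (N : R -> T -> nat)
    (tau : nat -> T -> R) : Prop :=
  [/\ forall w, 0 < tau 1%N w,
      forall i w, (1 <= i)%N -> tau i w < tau i.+1 w &
      forall t w, 0 <= t ->
        (N t w)%:R%:E = ereal_sup ([set 0%E] `|`
          [set n%:R%:E | n in [set n | (1 <= n)%N /\ tau n w <= t]])
        :> \bar R].

Definition discounted_claims (R : realType) (d : nat) (T : Type)
    (X : nat -> T -> 'rV[R]_d) (N : R -> T -> nat) (tau : nat -> T -> R)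
    (Z : R -> T -> R) (t : R) (w : T) : 'rV[R]_d :=
  \sum_(1 <= i < (N t w).+1) expR (- Z (tau i w) w) *: X i w.

(* Main.v *)
Require Import Defs.
From mathcomp Require Import all_boot all_order all_algebra finmap.
From mathcomp Require Import all_classical all_reals all_analysis.
From mathcomp Require Import measurable_realfun lra ring.

(** Write [Y] for [exit_level A] and [V] for the law of [Y] under [F].  A point
    lies in [x A] iff [Y] exceeds [x] there.  The complement of [A] is convex and
    contains 0, so [Y] is subadditive and positively homogeneous; [A] is
    increasing, so [Y] is monotone on the nonnegative orthant.  For positive
    weights [theta i] the level of [\sum_i theta i *: X i] therefore lies between
    the largest [theta i * Y (X i)] and their sum, and the problem is one about
    weighted sums of independent copies of a subexponential variable.

    Fix the number [n] of arrivals, the arrival times and the path of [Rt].  The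
    weights are then constants in an interval [(0, b]], and three estimates hold
    uniformly in them, where [x] is the level and the sums run over the [n]
    weights: the probability of exceeding [x] is at least [1 - o(1)] times
    [\sum_i tail V (x / theta i)] by Bonferroni's inequality
    ([sum_exceeds_ge]); it is at most [\sum_i tail V ((x - h) / theta i)] plus
    [e] times [\sum_i tail V (x / theta i)] for a suitable [h], because
    two parts of the sum are hardly ever both large
    ([subexponential_both_large], [sum_exceeds_le_sum]); and it is at most
    [r ^+ n] times [\sum_i tail V (x / theta i)], by a crude form of Kesten's
    bound ([sum_exceeds_geometric_bound]).

    The weights may be arbitrarily close to 0, and then the shift by [h] cannot
    be removed uniformly.  It disappears only after averaging: if
    [Theta] is a bounded positive factor independent of [Y], then [Theta * Y] is
    long-tailed ([mixed_tail_long_tailed]).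

    It remains to integrate.  Claims, arrivals and returns are independent, so
    their joint law is a product ([law_of_independent_triple]), and Campbell's
    formula ([campbell_formula]) shows that on the event of [n.+1] arrivals the
    sum of a function over the arrival times has expectation
    [lambda * poisson_pmf (lambda * T) n] times its integral over [[0, T]].  All
    three estimates are thus expressed by the integral in the statement, taken at
    [x] or at [x - h].  Divided by it, the probability of [n.+1] arrivals and
    [D(T)] in [x A] tends to [lambda * poisson_pmf (lambda * T) n] and is
    dominated by a summable sequence, and [tannery] adds up the limits to
    [lambda]. *)

Set Implicit Arguments.
Unset Strict Implicit.
Unset Printing Implicit Defensive.

Import Order.TTheory GRing.Theory Num.Theory.
Import numFieldTopology.Exports numFieldNormedType.Exports.

Local Open Scope classical_set_scope.
Local Open Scope ring_scope.

(** * Geometry of rare sets *)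

Section exit_level_geometry.
Context (R : realType) (d : nat) (A : rare_set R d).
Local Notation inA := (rare_set_val A).
Implicit Types (x y a : 'rV[R]_d) (u v r : R).
Local Notation Y := (exit_level A).

Lemma scale_setE u x : 0 < u -> scale_set u A x <-> inA (u^-1 *: x).
Proof.
move=> u0; split=> [[a Aa <-]|Ax]; first by rewrite scalerK// gt_eqF.
by exists (u^-1 *: x) => //; rewrite scalerKV// gt_eqF.
Qed.

Lemma rare_set0 : ~ inA 0.
Proof. by move=> A0; apply: (@rare_set_closure _ _ A); exact: subset_closure. Qed.

Lemma rare_setC_convex x y (t : R) : 0 <= t -> t <= 1 ->
  ~ inA x -> ~ inA y -> ~ inA (t *: x + (1 - t) *: y).
Proof.
move=> t0 t1 Ax Ay.
have t01 : Itv.spec (@Itv.num_sem _) (Itv.Real `[0%Z, 1%Z]) t.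
  by rewrite /= /Itv.num_sem/= in_itv/= t0 t1 realE t0.
have := @rare_set_convexC _ _ A x y (Itv.mk t01).
by rewrite !inE; apply.
Qed.

Lemma rare_set_scale x (t : R) : 0 <= t -> t <= 1 -> inA (t *: x) -> inA x.
Proof.
move=> t0 t1; apply: contraPP => Ax.
by have := rare_setC_convex t0 t1 Ax rare_set0; rewrite scaler0 addr0.
Qed.

Let levels_ubound x : has_ubound [set u : R | 0 < u /\ scale_set u A x].
Proof.
have /existsNP [U] := @rare_set_closure _ _ A.
move=> /not_implyP[/nbhs_ballP[e /= e0 eU] UA].
exists (`|x| / e) => u [u0 /(scale_setE _ u0) Aux].
rewrite ler_pdivlMr// leNgt; apply/negP => xue; apply: UA.
exists (u^-1 *: x); split => //; apply: eU.
rewrite -ball_normE /ball_ /= sub0r normrN normrZ gtr0_norm ?invr_gt0//.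
by rewrite ltr_pdivrMl.
Qed.

Lemma exit_level_ge0 x : 0 <= Y x.
Proof.
rewrite /exit_level; set S := [set u | _].
have [->|/set0P[u [u0 ux]]] := eqVneq S set0; first by rewrite sup0.
by apply: (le_trans (ltW u0)); apply: ub_le_sup => //; exact: levels_ubound.
Qed.

(** Openness of [A] puts a slightly larger multiple of [A] around each point
    of [u A]; convexity of the complement, which contains [0], makes the
    levels reached by [x] an interval. *)
Lemma exit_level_gtP u x : 0 < u -> scale_set u A x <-> u < Y x.
Proof.
move=> u0; split.
  move=> /(scale_setE _ u0) Aux.
  (* [s] is so small that shrinking [u^-1 *: x] by the factor [1 - s] moves it
     by less than the radius [e] of a ball around it inside [A]. *)
  have /nbhs_ballP[e /= e0 eA] := open_nbhs_nbhs (conj (@rare_set_open _ _ A) Aux).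
  pose n := `|u^-1 *: x| + 1.
  have n0 : 0 < n by rewrite ltr_wpDl.
  pose s := Num.min 2^-1 (e / (2 * n)).
  have s0 : 0 < s by rewrite lt_min invr_gt0 ltr0n divr_gt0// mulr_gt0.
  have s1 : s <= 2^-1 by rewrite ge_min lexx.
  have s2 : 0 < 1 - s by lra.
  have : inA ((1 - s) *: (u^-1 *: x)).
    apply: eA; rewrite -ball_normE /ball_ /= -{1}[u^-1 *: x]scale1r -scalerBl.
    rewrite opprB addrC subrK normrZ gtr0_norm//.
    have : s * n <= e / (2 * n) * n.
      by rewrite ler_wpM2r ?(ltW n0)// ge_min lexx orbT.
    rewrite (_ : e / (2 * n) * n = e / 2); last by field; rewrite gt_eqF.
    have : s * `|u^-1 *: x| <= s * n by rewrite ler_wpM2l ?(ltW s0)// lerDl.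
    lra.
  rewrite scalerA (_ : _ * u^-1 = (u / (1 - s))^-1); last by rewrite invf_div.
  move=> Ax; have us : 0 < u / (1 - s) by rewrite divr_gt0.
  have : u / (1 - s) <= Y x.
    by apply: ub_le_sup; [exact: levels_ubound|split => //; exact/scale_setE].
  by apply: lt_le_trans; rewrite ltr_pdivlMr// gtr_pMr//; lra.
move=> uY.
have : [set u : R | 0 < u /\ scale_set u A x] !=set0.
  apply/set0P/eqP => Sx; move: uY; rewrite /exit_level Sx sup0.
  by rewrite ltNge ltW.
move=> /sup_gt /(_ uY)[v [v0 /(scale_setE _ v0) Av] uv].
apply/scale_setE => //; apply: (@rare_set_scale _ (u / v)).
- by rewrite divr_ge0 ?ltW.
- by rewrite ler_pdivrMr// mul1r ltW.
- by rewrite scalerA mulrAC divff ?gt_eqF// mul1r.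
Qed.

Let exit_level_eq x r : 0 <= r ->
  (forall u, 0 < u -> scale_set u A x <-> u < r) -> Y x = r.
Proof.
move=> r0 H; apply/eqP; rewrite eq_le !leNgt; apply/andP; split; apply/negP.
  move=> rY; pose u := (r + Y x) / 2.
  have u0 : 0 < u by rewrite /u; lra.
  have /(exit_level_gtP _ u0)/(H _ u0) : u < Y x by rewrite /u; lra.
  by rewrite /u; lra.
move=> rY; pose u := (r + Y x) / 2; have Y0 := exit_level_ge0 x.
have u0 : 0 < u by rewrite /u; lra.
have /(H _ u0)/(exit_level_gtP _ u0) : u < r by rewrite /u; lra.
by rewrite /u; lra.
Qed.

Lemma exit_level0 : Y 0 = 0.
Proof.
apply: exit_level_eq => // u u0; split; last by rewrite ltNge ltW.
by move=> /(scale_setE _ u0); rewrite scaler0 => /rare_set0.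
Qed.

Lemma exit_levelZ (t : R) x : 0 < t -> Y (t *: x) = t * Y x.
Proof.
move=> t0; apply: exit_level_eq.
  by rewrite mulr_ge0 ?exit_level_ge0// ltW.
move=> u u0; rewrite (scale_setE _ u0) scalerA mulrC -(invf_div u t).
rewrite -(scale_setE _ _) ?divr_gt0// exit_level_gtP ?divr_gt0//.
by rewrite ltr_pdivrMr// mulrC.
Qed.

(** Subadditivity is convexity of the complement of [A] in disguise. *)
Lemma exit_levelD x y : Y (x + y) <= Y x + Y y.
Proof.
rewrite leNgt; apply/negP => YY.
pose e := (Y (x + y) - (Y x + Y y)) / 4.
have x0 := exit_level_ge0 x; have y0 := exit_level_ge0 y.
pose u := Y x + e; pose v := Y y + e.
have u0 : 0 < u by rewrite /u /e; lra.
have v0 : 0 < v by rewrite /v /e; lra.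
have uv0 : 0 < u + v by rewrite addr_gt0.
have Ax : ~ inA (u^-1 *: x).
  by move=> /(scale_setE _ u0)/(exit_level_gtP _ u0); rewrite /u /e; lra.
have Ay : ~ inA (v^-1 *: y).
  by move=> /(scale_setE _ v0)/(exit_level_gtP _ v0); rewrite /v /e; lra.
have t0 : 0 <= u / (u + v) by rewrite divr_ge0 ?ltW.
have t1 : u / (u + v) <= 1 by rewrite ler_pdivrMr// mul1r lerDl ltW.
apply: (rare_setC_convex t0 t1 Ax Ay).
rewrite !scalerA (_ : _ / u = (u + v)^-1); last first.
  by field; rewrite !gt_eqF.
rewrite (_ : (1 - u / (u + v)) / v = (u + v)^-1); last first.
  by field; rewrite !gt_eqF.
rewrite -scalerDr; apply/(scale_setE _ uv0)/(exit_level_gtP _ uv0).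
by rewrite /u /v /e; lra.
Qed.

Lemma exit_level_le x a : nneg_rV a -> Y x <= Y (x + a).
Proof.
move=> a0; rewrite leNgt; apply/negP => YY.
pose u := (Y x + Y (x + a)) / 2; have Y0 := exit_level_ge0 (x + a).
have u0 : 0 < u by rewrite /u; lra.
have : u < Y x by rewrite /u; lra.
move=> /(exit_level_gtP _ u0)/(scale_setE _ u0) Ax.
have : inA (u^-1 *: (x + a)).
  rewrite scalerDr; apply: rare_set_increasing => // j.
  by rewrite mxE mulr_ge0// invr_ge0 ltW.
by move=> /(scale_setE _ u0)/(exit_level_gtP _ u0); rewrite /u; lra.
Qed.

Lemma exit_level_sum_le (I : Type) (s : seq I) (c : I -> R) (x : I -> 'rV[R]_d) :
  (forall i, 0 < c i) ->
  Y (\sum_(i <- s) c i *: x i) <= \sum_(i <- s) c i * Y (x i).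
Proof.
move=> c0; elim: s => [|i s IH]; first by rewrite !big_nil exit_level0.
rewrite !big_cons; apply: (le_trans (exit_levelD _ _)).
by rewrite exit_levelZ// lerD2l.
Qed.

Lemma exit_level_sum_ge (I : eqType) (s : seq I) (c : I -> R)
    (x : I -> 'rV[R]_d) j : (forall i, 0 < c i) -> (forall i, nneg_rV (x i)) ->
  j \in s -> c j * Y (x j) <= Y (\sum_(i <- s) c i *: x i).
Proof.
move=> c0 x0 js; rewrite (big_rem j)//= -exit_levelZ//.
apply: exit_level_le => k; rewrite summxE sumr_ge0// => i _.
by rewrite mxE mulr_ge0 ?x0 ?ltW.
Qed.

End exit_level_geometry.

(** * Measurability of random vectors *)

Section measurable_rV.
Context (R : realType) (d : nat).

Lemma measurable_coord (j : 'I_d) :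
  measurable_fun setT (fun x : borel_rV R d => (x : 'rV[R]_d) ord0 j).
Proof.
move=> mT; apply: (measurability _ (RGenOpens.measurableE R)) => //.
move=> _ [_ [a [b ->]] <-]; rewrite setTI.
apply: sub_sigma_algebra; apply: open_comp; last exact: interval_open.
by move=> x _; exact: coord_continuous.
Qed.

(** Every open set is a countable union of cubes with rational data. *)
Lemma measurable_fun_rV (disp : measure_display) (T : measurableType disp)
    (f : T -> borel_rV R d) :
  (forall j, measurable_fun setT (fun w => (f w : 'rV[R]_d) ord0 j)) ->
  measurable_fun setT f.
Proof.
move=> mf mT.
have E : measurable = <<s (@open 'rV[R]_d : set (set (borel_rV R d))) >> by [].
apply: (measurability _ E) => // _ [U oU <-].
pose cube (p : 'rV[rat]_d * rat) : set 'rV[R]_d :=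
  [set x | forall j, `|ratr (p.1 ord0 j) - x ord0 j| < ratr p.2 :> R].
have -> : f @^-1` U =
    \bigcup_(p in [set p | cube p `<=` U]) (f @^-1` cube p).
  apply/seteqP; split => [w /= Ufw|w [p /= pU] /pU//].
  have /nbhs_ballP[e /= e0 eU] := open_nbhs_nbhs (conj oU Ufw).
  have e20 : 0 < e / 2 by rewrite divr_gt0.
  have [r /= r0e] := rat_in_itvoo e20.
  move: r0e; rewrite in_itv/= => /andP[r0 re].
  have /choice[q qP] j : exists q : rat, `|ratr q - (f w : 'rV[R]_d) ord0 j| < ratr r.
    have /rat_in_itvoo[q] : (f w : 'rV[R]_d) ord0 j - ratr r <
      (f w : 'rV[R]_d) ord0 j + ratr r by lra.
    by rewrite in_itv/= => /andP[? ?]; exists q; rewrite ltr_distlC; lra.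
  exists (\row_j q j, r); last by move=> j /=; rewrite mxE.
  move=> x /= xP; apply: eU; split=> // i j; rewrite !ord1.
  have := xP j; have := qP j; rewrite mxE /= => h1 h2.
  rewrite /ball /= (_ : _ - x ord0 j = (ratr (q j) - x ord0 j) -
    (ratr (q j) - (f w : 'rV[R]_d) ord0 j)); last by ring.
  by rewrite (le_lt_trans (ler_normB _ _))//; lra.
rewrite setTI bigcup_mkcond; apply: countable_bigcupT_measurable => // p.
case: ifPn => // _.
have -> : f @^-1` cube p = \bigcap_(j in [set: 'I_d])
    [set w | `|ratr (p.1 ord0 j) - (f w : 'rV[R]_d) ord0 j| < ratr p.2 :> R].
  by apply/seteqP; split => w /= H j; [move=> _; exact: H|exact: H].
apply: fin_bigcap_measurable => // j _.
have mg : measurable_fun setT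
    (fun w => `|ratr (p.1 ord0 j) - (f w : 'rV[R]_d) ord0 j| : R).
  by apply: measurableT_comp => //; exact: measurable_funB.
have := mg measurableT _ (measurable_itv `]-oo, (ratr p.2 : R)[).
by rewrite setTI set_itvE.
Qed.

End measurable_rV.

Lemma measurable_gt {disp : measure_display} {Z : measurableType disp}
    {R : realType} (f : Z -> R) (x : R) :
  measurable_fun setT f -> measurable [set z | x < f z].
Proof.
move=> mf; have := mf measurableT _ (measurable_itv `]x, +oo[).
by rewrite setTI set_itvE.
Qed.

Lemma measurable_ge {disp : measure_display} {Z : measurableType disp}
    {R : realType} (f : Z -> R) (x : R) :
  measurable_fun setT f -> measurable [set z | x <= f z].
Proof.
move=> mf; have := mf measurableT _ (measurable_itv `[x, +oo[).
by rewrite setTI set_itvE.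
Qed.

Lemma measurable_weighted_exceeds {disp : measure_display}
    {Z : measurableType disp} {R : realType} {d : nat} (A : rare_set R d)
    (theta : nat -> Z -> R) (X : nat -> Z -> borel_rV R d) (s : seq nat) (x : R) :
  (forall i, i \in s -> measurable_fun setT (theta i)) ->
  (forall i, i \in s -> measurable_fun setT (X i)) ->
  measurable [set z | x < exit_level A
    (\sum_(i <- s) theta i z *: (X i z : 'rV[R]_d))].
Proof.
move=> mt mX.
have mS : measurable_fun setT
    (fun z => (\sum_(i <- s) theta i z *: (X i z : 'rV[R]_d)) : borel_rV R d).
  apply: measurable_fun_rV => j.
  rewrite (_ : (fun w => _) =
      fun z => \sum_(i <- s) (theta i z * (X i z : 'rV[R]_d) ord0 j)); last first.
    by apply/funext => w; rewrite summxE; apply: eq_bigr => i _; rewrite mxE.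
  elim: s mt mX => [|k s IH] mt mX.
    by under eq_fun do rewrite big_nil; exact: measurable_cst.
  under eq_fun do rewrite big_cons.
  apply: measurable_funD.
    apply: measurable_funM; first by apply: mt; rewrite mem_head.
    apply: (measurableT_comp (measurable_coord j)).
    by apply: mX; rewrite mem_head.
  by apply: IH => i si; [apply: mt|apply: mX]; rewrite inE si orbT.
exact: (measurable_gt x (measurableT_comp (measurable_exit_level A) mS)).
Qed.

(** * Uniqueness of measures and independence *)

Lemma eq_measure_pi_system {disp : measure_display} {T : measurableType disp}
    {R : realType} (m1 m2 : {measure set T -> \bar R}) (G : set (set T)) :
  measurable = <<s G >> -> setI_closed G -> G setT -> (m1 setT < +oo)%E ->
  (forall A, G A -> m1 A = m2 A) -> forall A, measurable A -> m1 A = m2 A.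
Proof.
move=> mG GI GT m1oo m12 A mA; apply: (measure_unique G (fun=> setT)) => //.
by rewrite bigcup_const.
Qed.

Section independence.
Local Open Scope ereal_scope.
Context {disp : measure_display} {T : measurableType disp} {R : realType}.

(** Both sides are finite measures in [A], so it is enough to compare them on a
    pi-system. *)
Lemma independent_of_generated (P : probability T R) (D : set T)
    (G : set (set T)) : measurable D -> G `<=` measurable -> setI_closed G ->
  (forall A, G A -> P (D `&` A) = P D * P A) ->
  forall A, <<s G >> A -> P (D `&` A) = P D * P A.
Proof.
move=> mD mG GI GP A sA.
have PD0 : (0 <= fine (P D))%R by rewrite fine_ge0.
have PDE : ((NngNum PD0)%:num)%:E = P D.
  by rewrite /= fineK// fin_num_measure.
pose m1 : {measure set T -> \bar R} := mrestr P mD.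
pose m2 : {measure set T -> \bar R} := mscale (NngNum PD0) P.
have m12 B : G B -> m1 B = m2 B.
  by move=> GB; rewrite /m1 /m2 /= /mrestr /mscale PDE setIC GP.
suff : m1 A = m2 A by rewrite /m1 /m2 /= /mrestr /mscale PDE setIC.
apply: (@g_sigma_algebra_measure_unique _ _ _ (G `|` [set setT]) _ (fun=> setT)).
- by move=> B [/mG//|->]; exact: measurableT.
- by move=> i; right.
- by rewrite bigcup_const.
- move=> B C [GB|->] [GC|->]; rewrite ?setTI ?setIT; [left; exact: GI|by left|by left|by right].
- move=> B [/m12//|->].
  by rewrite /m1 /m2 /= /mrestr /mscale PDE setTI [X in _ * X]probability_setT mule1.
- by move=> _; rewrite /m1 /= /mrestr setTI (le_lt_trans (probability_le1 _ _))// ltry.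
- by apply: sub_sigma_algebra2 sA => B; left.
Qed.

(** The event [D] makes the lemma iterable: it may already carry the conditions
    on the random elements that have been treated before. *)
Lemma restricted_product_law {d1 d2 : measure_display}
    {T1 : measurableType d1} {T2 : measurableType d2}
    (P : probability T R) (m1 : probability T1 R) (m2 : probability T2 R)
    (D : set T) (f1 : T -> T1) (f2 : T -> T2) :
  measurable D -> measurable_fun setT f1 -> measurable_fun setT f2 ->
  (forall A B, measurable A -> measurable B ->
    P (D `&` (f1 @^-1` A `&` f2 @^-1` B)) = P D * (m1 A * m2 B)) ->
  forall S, measurable S ->
    P (D `&` [set w | S (f1 w, f2 w)]) = P D * (m1 \x m2) S.
Proof.
move=> mD mf1 mf2 DE S mS.
have mf : measurable_fun setT (fun w => (f1 w, f2 w)).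
  exact: measurable_fun_pair.
have PD0 : (0 <= fine (P D))%R by rewrite fine_ge0.
have PDE : ((NngNum PD0)%:num)%:E = P D.
  by rewrite /= fineK// fin_num_measure.
have [n1 n1E] : exists n1 : {measure set (T1 * T2) -> \bar R},
    forall A, n1 A = P (D `&` [set w | A (f1 w, f2 w)]).
  unshelve eexists
    (pushforward (mrestr P mD) (fun w => (f1 w, f2 w)) : {measure set _ -> \bar R}).
    exact: mf.
  by move=> A; rewrite /= /pushforward /mrestr setIC.
pose n2 : {measure set (T1 * T2) -> \bar R} := mscale (NngNum PD0) (m1 \x m2).
suff : n1 S = n2 S by rewrite n1E /n2 /= /mscale PDE.
pose C : set (set (T1 * T2)) := [set A `*` B | A in measurable & B in measurable].
apply: (eq_measure_pi_system (G := C)) => //.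
- by rewrite measurable_prod_measurableType.
- move=> _ _ [A1 mA1 [B1 mB1 <-]] [A2 mA2 [B2 mB2 <-]]; rewrite -setXI.
  exists (A1 `&` A2); first exact: measurableI.
  by exists (B1 `&` B2) => //; exact: measurableI.
- by exists setT => //; exists setT => //; rewrite setXTT.
- by rewrite n1E (le_lt_trans (probability_le1 _ _))// ?ltry// setIT.
- move=> _ [A mA [B mB <-]]; rewrite n1E /n2 /= /mscale PDE.
  by rewrite [X in _ * X](product_measure1E m1 m2 mA mB) -DE.
Qed.

(** Applying [restricted_product_law] twice turns independence of three random
    elements into a formula for their joint law. *)
Lemma law_of_independent_triple {d1 d2 d3 : measure_display}
    {T1 : measurableType d1} {T2 : measurableType d2} {T3 : measurableType d3}
    (P : probability T R) (f1 : {mfun T >-> T1}) (f2 : {mfun T >-> T2})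
    (f3 : {mfun T >-> T3}) :
  (forall A B C, measurable A -> measurable B -> measurable C ->
    P (f3 @^-1` C `&` (f1 @^-1` A `&` f2 @^-1` B)) =
    P (f3 @^-1` C) * (P (f1 @^-1` A) * P (f2 @^-1` B))) ->
  forall S, measurable S -> P [set w | S ((f1 w, f2 w), f3 w)] =
    ((distribution P f1 \x distribution P f2) \x distribution P f3) S.
Proof.
move=> H S mS.
have mpre d' (T' : measurableType d') (f : {mfun T >-> T'}) A :
    measurable A -> measurable (f @^-1` A).
  by move=> mA; rewrite -[X in measurable X]setTI; exact: measurable_funP.
have H12 C : measurable C -> forall S12, measurable S12 ->
    P (f3 @^-1` C `&` [set w | S12 (f1 w, f2 w)]) =
    P (f3 @^-1` C) * (distribution P f1 \x distribution P f2) S12.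
  move=> mC; apply: restricted_product_law => //; first exact: mpre.
  by move=> A B mA mB; rewrite H.
have := @restricted_product_law _ _ _ _ P
  (distribution P f1 \x distribution P f2) (distribution P f3) setT
  (fun w => (f1 w, f2 w)) f3 measurableT.
rewrite probability_setT => E.
have -> : [set w | S ((f1 w, f2 w), f3 w)] =
  setT `&` [set w | S ((f1 w, f2 w), f3 w)] by rewrite setTI.
rewrite E// ?mul1e//; first exact: measurable_fun_pair.
by move=> A B mA mB; rewrite setTI setIC H12// mul1e muleC.
Qed.

End independence.

(** * Real-valued probabilities and tails *)

Section real_probability.
Context {disp : measure_display} {T : measurableType disp} {R : realType}
  (P : probability T R).

Lemma fine_probability_ge0 A : 0 <= fine (P A).
Proof. by rewrite fine_ge0. Qed.

Lemma fine_probabilityK A : measurable A -> (fine (P A))%:E = P A.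
Proof. by move=> mA; rewrite fineK// fin_num_measure. Qed.

Lemma fine_probability_le A B : measurable A -> measurable B -> A `<=` B ->
  fine (P A) <= fine (P B).
Proof.
move=> mA mB AB; rewrite -lee_fin !fine_probabilityK//.
by rewrite le_measure// inE.
Qed.

Lemma fine_probability_le1 A : measurable A -> fine (P A) <= 1.
Proof. by move=> mA; rewrite -lee_fin fine_probabilityK// probability_le1. Qed.

Lemma fine_probabilityU A B : measurable A -> measurable B ->
  A `&` B = set0 -> fine (P (A `|` B)) = fine (P A) + fine (P B).
Proof.
move=> mA mB AB; apply: EFin_inj.
rewrite EFinD !fine_probabilityK ?measureU//; exact: measurableU.
Qed.

Lemma fine_probabilityU_le A B : measurable A -> measurable B ->
  fine (P (A `|` B)) <= fine (P A) + fine (P B).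
Proof.
move=> mA mB; rewrite -lee_fin EFinD !fine_probabilityK ?measureU2//.
exact: measurableU.
Qed.

Lemma fine_probability_3le A B C D : measurable A -> measurable B ->
  measurable C -> measurable D -> A `<=` D -> B `<=` D -> C `<=` D ->
  A `&` B = set0 -> A `&` C = set0 -> B `&` C = set0 ->
  fine (P A) + fine (P B) + fine (P C) <= fine (P D).
Proof.
move=> mA mB mC mD AD BD CD AB AC BC.
have mAB : measurable (A `|` B) by exact: measurableU.
rewrite -fine_probabilityU// -fine_probabilityU ?setIUl ?AC ?BC ?setU0//.
apply: fine_probability_le => //; last by rewrite !subUset.
exact: measurableU.
Qed.

End real_probability.

Lemma near_pinftyP (R : realType) (Q : R -> Prop) :
  (\forall x \near +oo, Q x) <-> exists2 x0, 0 < x0 & forall x, x0 <= x -> Q x.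
Proof.
split=> [[M [_ MQ]]|[x0 _ x0Q]].
  exists (`|M| + 1); first by rewrite ltr_wpDl.
  move=> x Mx; apply: MQ; rewrite (lt_le_trans _ Mx)//.
  by rewrite (le_lt_trans (ler_norm _))// ltrDl.
by exists x0; split => [|x /ltW/x0Q//]; exact: num_real.
Qed.

Section tails.
Context {R : realType}.
Implicit Types (V W : probability R R) (x h : R).

Lemma tail_ge0 V x : 0 <= tail V x.
Proof. exact: fine_probability_ge0. Qed.

Lemma tail_le1 V x : tail V x <= 1.
Proof. exact: fine_probability_le1. Qed.

Lemma tailE V x : V `]x, +oo[%classic = (tail V x)%:E.
Proof. by rewrite fine_probabilityK. Qed.

Lemma le_tail V x y : x <= y -> tail V y <= tail V x.
Proof.
move=> xy; apply: fine_probability_le => // z /=.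
by rewrite !in_itv/= !andbT; exact: le_lt_trans.
Qed.

Lemma tail_cvg0 V : tail V @ +oo --> (0 : R).
Proof.
have mid : measurable_fun setT (fun x : R => x) by exact: measurable_id.
pose idR : {RV V >-> R} := mfun_Sub (mem_set mid).
have := cvg_ccdfy0 idR => /fine_cvg; apply: cvg_trans.
by apply: near_eq_cvg; near=> x.
Unshelve. all: by end_near. Qed.

Lemma tail_dirac0 x : 0 <= x -> tail \d_(0 : R) x = 0.
Proof.
move=> x0; rewrite /tail /= /dirac indicE memNset//= in_itv/= andbT.
by apply/negP; rewrite -leNgt.
Qed.

Lemma fine_itv0 V h : V `]-oo, 0[%classic = 0%E -> 0 <= h ->
  fine (V `[0, h]%classic) = 1 - tail V h.
Proof.
move=> V0 h0; apply/eqP; rewrite eq_sym subr_eq; apply/eqP.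
have -> : (1 : R) = fine (V (`]-oo, 0[ `|` (`[0, h] `|` `]h, +oo[))).
  rewrite -[LHS]/(fine (1%:E)) -(probability_setT V); congr (fine (V _)).
  apply/seteqP; split => // x _ /=; rewrite !in_itv/= andbT.
  by case: (ltP x 0) => [|x0]; [left|right; case: (leP x h); [left|right]].
rewrite !fine_probabilityU//.
- by rewrite V0 add0r.
- apply/seteqP; split => // x [] /=; rewrite !in_itv/= andbT => /andP[_ xh].
  by rewrite ltNge xh.
- by exact: measurableU.
- apply/seteqP; split => // x [] /=; rewrite !in_itv/= andbT => x0 [/andP[]|].
    by rewrite leNgt x0.
  by move=> hx; move: (lt_trans hx x0); rewrite ltNge h0.
Qed.

Lemma measurable_add_gt x : measurable [set p : R * R | x < p.1 + p.2].
Proof.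
have := @measurable_addp R measurableT _ (measurable_itv `]x, +oo[).
by rewrite setTI set_itvE.
Qed.

Lemma tail_convolution V W x :
  tail (convolution V W) x = fine ((V \x W)%E [set p | x < p.1 + p.2]).
Proof. by rewrite /tail /convolution /distribution /pushforward set_itvE. Qed.

Lemma fine_product V W (A B : set R) : measurable A -> measurable B ->
  fine ((V \x W)%E (A `*` B)) = fine (V A) * fine (W B).
Proof.
move=> mA mB; rewrite [(V \x W)%E _](product_measure1E V W mA mB) fineM//.
- exact: fin_num_measure.
- exact: fin_num_measure.
Qed.

Lemma convolution_ge0 V W : V `]-oo, 0[%classic = 0%E ->
  W `]-oo, 0[%classic = 0%E -> convolution V W `]-oo, 0[%classic = 0%E.
Proof.
move=> V0 W0; apply/eqP; rewrite eq_le measure_ge0 andbT.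
apply: (@le_trans _ _ ((V \x W) (`]-oo, 0%R[ `*` setT `|` setT `*` `]-oo, 0%R[))%E).
  apply: (@le_measure _ _ _ (V \x W)%E); rewrite ?inE//.
  - have := @measurable_addp R measurableT _ (measurable_itv `]-oo, 0[).
    by rewrite setTI.
  - by apply: measurableU; exact: measurableX.
  move=> [y z] /=; rewrite !in_itv/= /addp/= => yz.
  by case: (ltP y 0) => y0; [left|right]; split => //; lra.
apply: (le_trans (@measureU2 _ _ _ (V \x W)%E _ _ _ _)); [exact: measurableX..|].
rewrite [X in (X + _)%E](product_measure1E V W)// [X in (_ + X)%E](product_measure1E V W)//.
by rewrite [X in (X * _ + _)%E]V0 [X in (_ + _ * X)%E]W0 mul0e mule0 adde0.
Qed.

Lemma convolution_pow_ge0 V n : V `]-oo, 0[%classic = 0%E ->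
  convolution_pow V n `]-oo, 0[%classic = 0%E.
Proof.
move=> V0; elim: n => [|n IH] /=; last exact: convolution_ge0.
by rewrite /dirac indicE memNset//= in_itv/= ltxx.
Qed.

Lemma tail_convolution_dirac0 V x : tail (convolution V \d_(0 : R)) x = tail V x.
Proof.
apply/eqP; rewrite tail_convolution eq_le; apply/andP; split.
  have -> : tail V x = fine ((V \x \d_(0%R : R))%E (`]x, +oo[ `*` [set 0])) +
      fine ((V \x \d_(0%R : R))%E (setT `*` ~` [set 0])).
    rewrite !fine_product//; last exact: measurableC.
    rewrite /= /dirac !indicE mem_set// memNset ?mulr1 ?mulr0 ?addr0//.
    by apply.
  apply: le_trans (fine_probabilityU_le (V \x \d_(0%R : R))%E _ _).
  - apply: fine_probability_le.
    + exact: measurable_add_gt.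
    + by apply: measurableU; apply: measurableX => //; exact: measurableC.
    + move=> [y z]/=; rewrite in_itv/= andbT => xyz.
      by have [z0|/eqP] := eqVneq z 0; [left; split => //; lra|right].
  - exact: measurableX.
  - by apply: measurableX => //; exact: measurableC.
have -> : tail V x = fine ((V \x \d_(0%R : R))%E (`]x, +oo[ `*` [set 0])).
  by rewrite fine_product// /= /dirac indicE mem_set// mulr1.
apply: fine_probability_le; [exact: measurableX|exact: measurable_add_gt|].
by move=> [y z] /= []; rewrite in_itv/= andbT => ? ->; rewrite addr0.
Qed.

End tails.

(** * Subexponential laws *)

Section interval_probabilities.
Context {R : realType}.
Implicit Types (V W : probability R R) (x h : R).

Lemma fine_itv_oc V h x : h <= x -> fine (V `]h, x]%classic) = tail V h - tail V x.
Proof.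
move=> hx; apply/eqP; rewrite -subr_eq opprK; apply/eqP.
rewrite /tail -fine_probabilityU//.
  congr (fine (V _)); apply/seteqP; split => z /=; rewrite !in_itv/= !andbT.
    by move=> [/andP[]//|/(le_lt_trans hx)].
  by move=> hz; case: (leP z x) => zx; [left; rewrite hz|right].
apply/seteqP; split => z //= []; rewrite !in_itv/= andbT => /andP[_ zx].
by rewrite ltNge zx.
Qed.

Lemma fine_itv0y V : V `]-oo, 0[%classic = 0%E -> fine (V `[0, +oo[%classic) = 1.
Proof.
move=> V0; have -> : `[0, +oo[%classic = ~` `]-oo, (0 : R)[%classic.
  by rewrite setCitvl.
by rewrite probability_setC// V0 sube0.
Qed.

Local Notation overshoot x := [set p : R * R | p.1 <= x /\ x < p.1 + p.2].

Let measurable_overshoot x : measurable (overshoot x).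
Proof.
have -> : overshoot x = `]-oo, x] `*` setT `&` [set p | x < p.1 + p.2].
  by apply/seteqP; split => -[y z] /=; rewrite in_itv/=; tauto.
by apply: measurableI; [exact: measurableX|exact: measurable_add_gt].
Qed.

(** Given a first summand at most [x], the second has to exceed a nonnegative
    level, where its tail may be compared with another one. *)
Lemma overshoot_le V W W' (c : R) x : 0 <= c ->
  (forall u, 0 <= u -> tail W u <= c * tail W' u) ->
  fine ((V \x W)%E (overshoot x)) <= c * fine ((V \x W')%E (overshoot x)).
Proof.
move=> c0 WW; rewrite -lee_fin EFinM.
rewrite (fine_probabilityK (V \x W)%E)// (fine_probabilityK (V \x W')%E)//.
rewrite /= /product_measure1 -ge0_integralZl_EFin//; last exact: measurable_fun_xsection.
apply: ge0_le_integral => //.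
- exact: measurable_fun_xsection.
- by apply: measurable_funeM; exact: measurable_fun_xsection.
move=> y _ /=; have [yx|xy] := leP y x.
  have E : xsection (overshoot x) y = `]x - y, +oo[%classic.
    apply/seteqP; split => z; rewrite /xsection/= inE/= in_itv/= andbT.
      by move=> [_]; rewrite ltrBlDl.
    by move=> h; split => //; rewrite -ltrBlDl.
  by rewrite E !tailE -EFinM lee_fin WW// subr_ge0.
have -> : xsection (overshoot x) y = set0.
  apply/seteqP; split => z //; rewrite /xsection/= inE/= => -[].
  by rewrite leNgt xy.
by rewrite !measure0 mule0.
Qed.

Lemma tail_convolution_le V W x :
  tail (convolution V W) x <= tail V x + fine ((V \x W)%E (overshoot x)).
Proof.
rewrite tail_convolution.
have -> : tail V x = fine ((V \x W)%E (`]x, +oo[ `*` setT)).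
  by rewrite fine_product// probability_setT mulr1.
apply: le_trans (fine_probabilityU_le (V \x W)%E _ _) => //; last exact: measurableX.
apply: fine_probability_le => //; first exact: measurable_add_gt.
  by apply: measurableU => //; exact: measurableX.
move=> [y z] /= xyz; have [yx|xy] := leP y x; [by right|left].
by rewrite in_itv/= xy.
Qed.

Lemma overshoot_le_tail V W x :
  fine ((V \x W)%E (overshoot x)) <= tail (convolution V W) x.
Proof.
rewrite tail_convolution; apply: fine_probability_le => //.
  exact: measurable_add_gt.
by move=> p [].
Qed.

End interval_probabilities.

Section subexponential_laws.
Context {R : realType} (V : probability R R) (V_subexp : subexponential V).
Implicit Types (x h e : R).

Let V0 : V `]-oo, 0[%classic = 0%E. Proof. by case: V_subexp. Qed.

Lemma subexponential_tail_gt0 x : 0 <= x -> 0 < tail V x.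
Proof. by case: V_subexp => _ + _; apply. Qed.

Lemma subexponential_ratio n :
  (fun x => tail (convolution_pow V n) x / tail V x) @ +oo --> (n%:R : R).
Proof.
have x0near : \forall x \near +oo, (0 : R) <= x by exact: nbhs_pinfty_ge.
case: n => [|[|n]]; last by case: V_subexp => _ _; apply.
  apply: cvg_near_cst; near=> x.
  by rewrite /= tail_dirac0 ?mul0r//; near: x.
apply: cvg_near_cst; near=> x.
rewrite /= tail_convolution_dirac0 divff// gt_eqF// subexponential_tail_gt0//; near: x.
Unshelve. all: by end_near. Qed.

Let ratio_near n e : 0 < e -> \forall x \near +oo,
  (n%:R - e) * tail V x <= tail (convolution_pow V n) x <= (n%:R + e) * tail V x.
Proof.
move=> e0; have /cvgrPdist_le/(_ e e0) := @subexponential_ratio n.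
move=> H; near=> x.
have t0 : 0 < tail V x by apply: subexponential_tail_gt0; near: x; apply: nbhs_pinfty_ge; exact: num_real.
have : `|n%:R - tail (convolution_pow V n) x / tail V x| <= e by near: x.
by rewrite ler_distlC ler_pdivlMr// ler_pdivrMr.
Unshelve. all: by end_near. Qed.

Let tail_near (W : probability R R) e : 0 < e -> \forall x \near +oo, tail W x <= e.
Proof.
move=> e0; have /cvgrPdist_le/(_ e e0) := tail_cvg0 W; apply: filterS => x.
by rewrite sub0r normrN ger0_norm ?tail_ge0.
Qed.

(** If the tail dropped noticeably between [x - h] and [x], then a sum with one
    summand in [(x - h, x]] and the other beyond [h] would push the tail of the
    sum of two copies above twice the tail of [V]. *)
Lemma subexponential_long_tailed h e : 0 <= h -> 0 < e ->
  \forall x \near +oo, tail V (x - h) <= (1 + e) * tail V x.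
Proof.
move=> h0 e0; set t := tail V.
have th0 : 0 < t h by exact: subexponential_tail_gt0.
pose k := e * t h / 4.
have k0 : 0 < k by rewrite /k divr_gt0// mulr_gt0.
near=> x.
have hx : h <= x by near: x; apply: nbhs_pinfty_ge; exact: num_real.
have tx0 : 0 < t x by apply: subexponential_tail_gt0; apply: le_trans hx.
have /andP[_] : (2%:R - k) * t x <= tail (convolution_pow V 2) x <=
    (2%:R + k) * t x by near: x; exact: ratio_near.
have k2 : (1 + e) * t x <= k.
  rewrite mulrC -ler_pdivlMr ?addr_gt0//; near: x.
  by apply: tail_near; rewrite divr_gt0// addr_gt0.
have txh : t x < t h.
  have : t x <= t h / 2 by near: x; apply: tail_near; rewrite divr_gt0.
  by move=> /le_lt_trans; apply; rewrite ltr_pdivrMr// ltr_pMr// ltr1n.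
rewrite [convolution_pow V 2]/(convolution V (convolution_pow V 1)).
set W := convolution_pow V 1.
have tW y : tail W y = t y by rewrite /W /= tail_convolution_dirac0.
have W0 : W `]-oo, 0[%classic = 0%E by exact: convolution_pow_ge0.
rewrite tail_convolution => H.
have : t x + t x * (1 - t h) + t (x - h) * (t h - t x) <= (2 + k) * t x.
  apply: le_trans H.
  have E1 : t x = fine ((V \x W)%E (`[0, +oo[ `*` `]x, +oo[)).
    by rewrite fine_product// fine_itv0y// mul1r -tW.
  have E2 : t x * (1 - t h) = fine ((V \x W)%E (`]x, +oo[ `*` `[0, h])).
    by rewrite fine_product// fine_itv0// tW.
  have E3 : t (x - h) * (t h - t x) =
      fine ((V \x W)%E (`](x - h), +oo[ `*` `]h, x])).
    by rewrite fine_product// fine_itv_oc// !tW.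
  rewrite {1}E1 E2 E3; apply: fine_probability_3le.
  - exact: measurableX.
  - exact: measurableX.
  - exact: measurableX.
  - exact: measurable_add_gt.
  - by move=> [y z] /=; rewrite !in_itv/= !andbT => -[]; exact: ltr_wpDl.
  - move=> [y z] /=; rewrite !in_itv/= !andbT => -[xy /andP[z0 _]].
    exact: ltr_wpDr.
  - move=> [y z] /=; rewrite !in_itv/= !andbT => -[xy /andP[hz _]].
    by rewrite -(subrK h x) ltrD.
  - apply/seteqP; split => -[y z] //=; rewrite !in_itv/= !andbT.
    by move=> [[_ xz] [_ /andP[_ zh]]]; move: (lt_le_trans xz zh); rewrite ltNge hx.
  - apply/seteqP; split => -[y z] //=; rewrite !in_itv/= !andbT.
    by move=> [[_ xz] [_ /andP[_ zx]]]; move: (lt_le_trans xz zx); rewrite ltxx.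
  - apply/seteqP; split => -[y z] //=; rewrite !in_itv/= !andbT.
    by move=> [[_ /andP[_ zh]] [_ /andP[hz _]]]; move: hz; rewrite ltNge zh.
move=> H3; have th1 : 0 < t h - t x by rewrite subr_gt0.
rewrite -(ler_pM2r th1); apply: (@le_trans _ _ (t x * (t h + k))).
  by move: H3; rewrite !(mulrDl, mulrDr, mulrBl, mulrBr, mulr1, mul1r); lra.
rewrite mulrAC [leRHS]mulrC ler_wpM2l ?(ltW tx0)//.
have k4 : e * t h = 4 * k by rewrite /k; field.
rewrite mulrBr [X in _ <= X - _]mulrDl mul1r k4.
by lra.
Unshelve. all: by end_near. Qed.

(** The heart of the single-big-jump principle: two independent summands cannot
    both be large.  The sum of [n.+1] copies has tail about [n.+1] times that of
    [V], and these [n.+1] units are already used up by the two events in which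
    one part alone exceeds [x] while the other stays below [h]. *)
Lemma subexponential_both_large n e : 0 < e -> exists2 h, 0 < h &
  \forall x \near +oo,
    fine ((V \x convolution_pow V n)%E
      [set p : R * R | [/\ h < p.1, h < p.2 & x < p.1 + p.2]])
    <= e * tail V x.
Proof.
move=> e0; set t := tail V; set W := convolution_pow V n; set w := tail W.
have W0 : W `]-oo, 0[%classic = 0%E by exact: convolution_pow_ge0.
have n0 : (0 : R) < n.+1%:R by [].
have e4 : 0 < e / 4 by rewrite divr_gt0.
have [h h0 [wh th]] : exists2 h, 0 < h & w h <= e / 4 /\ n.+1%:R * t h <= e / 4.
  have [h0 h00 Hh] : exists2 h0, 0 < h0 & forall h, h0 <= h ->
      w h <= e / 4 /\ t h <= e / 4 / n.+1%:R.
    by apply/near_pinftyP; near do split; apply: tail_near => //; exact: divr_gt0.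
  exists h0 => //; have [? ?] := Hh h0 (lexx _); split => //.
  by rewrite mulrC -ler_pdivlMr.
exists h => //; near=> x.
have hx : h <= x by near: x; apply: nbhs_pinfty_ge; exact: num_real.
have tx0 : 0 < t x by apply: subexponential_tail_gt0; rewrite (le_trans (ltW h0)).
have /andP[wx _] : (n%:R - e / 4) * t x <= w x <= (n%:R + e / 4) * t x.
  by near: x; exact: ratio_near.
have /andP[_] : (n.+1%:R - e / 4) * t x <= tail (convolution_pow V n.+1) x <=
    (n.+1%:R + e / 4) * t x by near: x; exact: ratio_near.
rewrite [convolution_pow V n.+1]/(convolution V W) tail_convolution => H.
set C := [set p | _].
have mC : measurable C.
  have -> : C = (`]h, +oo[ `*` `]h, +oo[) `&` [set p : R * R | x < p.1 + p.2].
    apply/seteqP; split => -[y z]; rewrite /C /= !in_itv/= !andbT.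
      by move=> [].
    by move=> [[]].
  by apply: measurableI; [exact: measurableX|exact: measurable_add_gt].
have : t x * (1 - w h) + (1 - t h) * w x + fine ((V \x W)%E C) <=
    (n.+1%:R + e / 4) * t x.
  apply: le_trans H.
  have -> : t x * (1 - w h) = fine ((V \x W)%E (`]x, +oo[ `*` `[0, h])).
    by rewrite fine_product// fine_itv0// ltW.
  have -> : (1 - t h) * w x = fine ((V \x W)%E (`[0, h] `*` `]x, +oo[)).
    by rewrite fine_product// fine_itv0// ltW.
  apply: fine_probability_3le => //.
  - exact: measurableX.
  - exact: measurableX.
  - exact: measurable_add_gt.
  - move=> [y z] /=; rewrite !in_itv/= !andbT => -[xy /andP[z0 _]].
    exact: ltr_wpDr.
  - move=> [y z] /=; rewrite !in_itv/= !andbT => -[/andP[y0 _]].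
    exact: ltr_wpDl.
  - by move=> [y z] [].
  - apply/seteqP; split => -[y z] //=; rewrite !in_itv/= !andbT.
    by move=> [[xy _] [/andP[_ yh] _]]; move: (lt_le_trans xy yh); rewrite ltNge hx.
  - apply/seteqP; split => -[y z] //=; rewrite /C/= !in_itv/= !andbT.
    by move=> [[_ /andP[_ zh]] [_ hz _]]; move: hz; rewrite ltNge ?zh ?yh.
  - apply/seteqP; split => -[y z] //=; rewrite /C/= !in_itv/= !andbT.
    by move=> [[/andP[_ yh] _] [hz _ _]]; move: hz; rewrite ltNge ?zh ?yh.
have th1 : t h <= 1 by exact: tail_le1.
have H1 : t x * w h <= t x * (e / 4) by rewrite ler_wpM2l// ltW.
have H2 : (1 - t h) * ((n%:R - e / 4) * t x) <= (1 - t h) * w x.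
  by rewrite ler_wpM2l// subr_ge0.
have H3 : n.+1%:R * t h * t x <= e / 4 * t x by rewrite ler_wpM2r// ltW.
have H4 : 0 <= t h * t x by rewrite mulr_ge0 ?tail_ge0.
have H5 : 0 <= e / 4 * (t h * t x) by rewrite mulr_ge0 ?(ltW e4).
by move: H1 H2 H3 H4 H5; rewrite -[n.+1%:R]natr1; lra.
Unshelve. all: by end_near. Qed.

Let two_fold_bound : exists2 c, 1 <= c & forall x, 0 <= x ->
  tail (convolution_pow V 2) x <= c * tail V x.
Proof.
have /near_pinftyP[x0 x00 Hx0] := @ratio_near 2 1 ltr01.
have t0 : 0 < tail V x0 by apply: subexponential_tail_gt0; exact: ltW.
have ti : 0 < (tail V x0)^-1 by rewrite invr_gt0.
exists (3 + (tail V x0)^-1); first by lra.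
move=> x x_ge0; have tx := subexponential_tail_gt0 x_ge0.
have [xx0|/ltW xx0] := leP x0 x.
  have /andP[_] := Hx0 x xx0; have : 0 <= (tail V x0)^-1 * tail V x.
    by rewrite mulr_ge0 ?tail_ge0 ?ltW.
  by rewrite !mulrDl mul1r; lra.
rewrite (le_trans (tail_le1 _ _))// mulrDl.
have : 1 <= (tail V x0)^-1 * tail V x by rewrite mulrC ler_pdivlMr// mul1r le_tail.
by have := tx; lra.
Qed.

(** A crude form of Kesten's bound.  Its rate [r] need not be close to 1,
    but the probabilities of a Poisson law decay faster than any geometric
    sequence. *)
Lemma subexponential_geometric_bound : exists2 r : R, 1 <= r &
  forall n x, 0 <= x -> tail (convolution_pow V n) x <= r ^+ n * tail V x.
Proof.
have [c c1 cP] := two_fold_bound; exists (1 + c); first by lra.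
have r1 : 1 <= 1 + c by lra.
elim=> [|n IH] x x0; first by rewrite /= tail_dirac0// mul1r tail_ge0.
rewrite [convolution_pow V n.+1]/(convolution V (convolution_pow V n)).
rewrite (le_trans (tail_convolution_le _ _ _))//.
have rn : 0 <= (1 + c) ^+ n by rewrite exprn_ge0//; lra.
have rn1 : 1 <= (1 + c) ^+ n by rewrite exprn_ege1.
have H : forall u, 0 <= u -> tail (convolution_pow V n) u <=
    (1 + c) ^+ n * tail (convolution_pow V 1) u.
  by move=> u u0; rewrite [tail (convolution_pow V 1) u]tail_convolution_dirac0 IH.
have := overshoot_le V x rn H.
have := le_trans (overshoot_le_tail V (convolution_pow V 1) x) (cP x x0).
move=> /(ler_wpM2l rn) h1 /le_trans/(_ h1) h2.
have h3 : tail V x <= (1 + c) ^+ n * tail V x by rewrite ler_peMl ?tail_ge0.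
rewrite exprS mulrAC mulrDl mul1r; move: h2 h3; rewrite mulrCA.
by rewrite [_ * ((1 + c) ^+ n)]mulrC; lra.
Qed.

End subexponential_laws.

(** * Tails under a bounded random scaling *)

Section randomly_scaled_tail.
Context {R : realType} (V : probability R R).

Lemma measurable_tail : measurable_fun setT (tail V).
Proof.
by apply: nonincreasing_measurable => // x y xy; exact: le_tail.
Qed.

Context {disp : measure_display} {Z : measurableType disp}
  (m : {finite_measure set Z -> \bar R}) (Theta : Z -> R) (b : R).
Hypotheses (mTheta : measurable_fun setT Theta)
  (Theta_gt0 : forall z, 0 < Theta z) (Theta_le : forall z, Theta z <= b)
  (m_gt0 : (0 < m setT)%E).
Implicit Types (x h e : R).

Lemma measurable_scaled_tail x :
  measurable_fun setT (fun z => (tail V (x / Theta z))%:E).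
Proof.
apply/measurable_EFinP; apply: (measurableT_comp measurable_tail).
apply: measurable_funM => //.
move=> mT; apply: (measurability _ (RGenOInfty.measurableE R)) => //.
move=> _ [_ [r ->] <-].
have mr : measurable_fun setT (fun z => r * Theta z) by exact: measurable_funM.
have := mr measurableT _ (measurable_itv `]-oo, 1[); congr measurable.
apply/seteqP; split => z [_] /=; rewrite !in_itv/= ?andbT => rT; split => //=.
  by rewrite -[ltRHS]mul1r ltr_pdivlMr.
by rewrite -ltr_pdivlMr// mul1r.
Qed.

Definition mixed_tail x := (\int[m]_z (tail V (x / Theta z))%:E)%E.

Lemma mixed_tail_ge0 x : (0 <= mixed_tail x)%E.
Proof. by apply: integral_ge0 => z _; rewrite lee_fin tail_ge0. Qed.

Lemma mixed_tail_fin_num x : mixed_tail x \is a fin_num.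
Proof.
rewrite ge0_fin_numE ?mixed_tail_ge0//.
apply: (@le_lt_trans _ _ (\int[m]_z 1)%E); last first.
  by rewrite integral_cst// mul1e ltey_eq fin_num_measure.
apply: ge0_le_integral => //.
- by move=> z _; rewrite lee_fin tail_ge0.
- exact: measurable_scaled_tail.
- by move=> z _; rewrite lee_fin tail_le1.
Qed.

Let measurable_lt d : measurable [set z | Theta z < d].
Proof.
by have := mTheta measurableT (measurable_itv `]-oo, d[); rewrite setTI set_itvE.
Qed.

Let small_values (eta : R) : 0 < eta ->
  exists2 d, 0 < d & (m [set z | (Theta z < d)%R] <= eta%:E)%E.
Proof.
move=> eta0; pose F n := [set z | Theta z < n.+1%:R^-1].
have F0 : \bigcap_n F n = set0.
  apply/seteqP; split => // z Fz.
  have [n] := ltr_add_invr (Theta_gt0 z); rewrite add0r => nT.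
  by have := Fz n I; rewrite /F/= ltNge ltW.
have := @nonincreasing_cvg_mu _ _ _ m F.
rewrite F0 measure0 => /(_ _ _ _ _)/fine_cvgP[].
- by rewrite ltey_eq fin_num_measure//; exact: measurable_lt.
- by move=> n; exact: measurable_lt.
- by [].
- move=> n k nk; apply/subsetPset => z; rewrite /F/= => /lt_le_trans; apply.
  by rewrite lef_pV2 ?posrE// ler_nat.
move=> _ /cvgrPdist_le/(_ _ eta0)[n _ /(_ n (leqnn n))].
rewrite sub0r normrN ger0_norm ?fine_ge0//= => Hn.
exists n.+1%:R^-1; first by rewrite invr_gt0.
rewrite -(@fineK _ (m _)) ?lee_fin//; exact/fin_num_measure/measurable_lt.
Qed.

Let mixed_tail_ge d x : 0 < d -> 0 <= x ->
  ((tail V (x / d))%:E * m [set z | (d <= Theta z)%R] <= mixed_tail x)%E.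
Proof.
move=> d0 x0; have mA : measurable [set z | d <= Theta z] by exact: measurable_ge.
rewrite -(@integral_cst _ _ _ m _ mA)/=.
apply: (@le_trans _ _ (\int[m]_(z in [set z | (d <= Theta z)%R])
    (tail V (x / Theta z))%:E)%E).
  apply: ge0_le_integral => //.
  - by move=> z _; rewrite lee_fin tail_ge0.
  - by apply: measurable_funTS; exact: measurable_scaled_tail.
  - move=> z /= dT; rewrite lee_fin le_tail// ler_wpM2l//.
    by rewrite lef_pV2 ?posrE// Theta_gt0.
apply: ge0_subset_integral => //; first exact: measurable_scaled_tail.
by move=> z _; rewrite lee_fin tail_ge0.
Qed.

Let large_values : exists2 d, 0 < d & (0 < m [set z | (d <= Theta z)%R])%E.
Proof.
have mT : (fine (m setT))%:E = m setT by rewrite fineK// fin_num_measure.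
have fm : 0 < fine (m setT) by rewrite -lte_fin mT.
have [d d0 dP] := small_values (divr_gt0 fm (ltr0n _ 2)).
exists d => //; rewrite lt0e measure_ge0 andbT; apply/eqP => mA.
have : (m setT <= m [set z | (Theta z < d)%R] + m [set z | (d <= Theta z)%R])%E.
  have mD : measurable [set z | d <= Theta z] by exact: measurable_ge.
  apply: le_trans (measureU2 m (measurable_lt d) mD).
  rewrite le_measure ?inE//; first exact: measurableU.
  by move=> z _ /=; case: (ltP (Theta z) d) => ?; [left|right].
rewrite mA adde0 => /le_trans/(_ dP); rewrite -mT lee_fin.
by have := fm; lra.
Qed.

Lemma mixed_tail_gt0 x : (forall y, 0 <= y -> 0 < tail V y) -> 0 <= x ->
  (0 < mixed_tail x)%E.
Proof.
move=> V_gt0 x0; have [d d0 dP] := large_values.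
apply: lt_le_trans (mixed_tail_ge d0 x0).
by rewrite mule_gt0// lte_fin V_gt0// divr_ge0// ltW.
Qed.

(** Scaling by an independent bounded factor preserves long tails.  Where
    [Theta] is bounded below this is the long tail of [V]; the set where
    [Theta] is small contributes at most its mass times the tail at a much
    higher level, which the values of [Theta] of order one dominate. *)
Lemma mixed_tail_long_tailed h e : subexponential V -> 0 <= h -> 0 < e ->
  \forall x \near +oo, (mixed_tail (x - h) <= (1 + e)%:E * mixed_tail x)%E.
Proof.
move=> V_subexp h0 e0.
have e2 : 0 < e / 2 by rewrite divr_gt0.
have [d0 d00 kappa0] := large_values.
set A := [set z | (d0 <= Theta z)%R] in kappa0.
have mA : measurable A by exact: measurable_ge.
have kE : (fine (m A))%:E = m A by rewrite fineK// fin_num_measure.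
have k0 : 0 < fine (m A) by rewrite -lte_fin kE.
have [d1 d10 d1P] := small_values (mulr_gt0 e2 k0).
pose d := Num.min d1 (d0 / 2).
have d_gt0 : 0 < d by rewrite lt_min d10 divr_gt0.
have dd0 : d <= d0 / 2 by rewrite ge_min lexx orbT.
pose B := [set z | (Theta z < d)%R].
have mB : measurable B by exact: measurable_lt.
have mBle : (m B <= (e / 2 * fine (m A))%:E)%E.
  apply: le_trans d1P; rewrite le_measure ?inE//.
  by move=> z; rewrite /B/= lt_min => /andP[].
have /near_pinftyP[y0 y00 y0P] :=
  @subexponential_long_tailed _ V V_subexp (h / d) _ (divr_ge0 h0 (ltW d_gt0)) e2.
(* [2 * h] makes [(x - h) / d] exceed [x / d0]; [y0 * b] makes [x / Theta z]
   exceed [y0] for every [z]. *)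
apply/near_pinftyP; exists (Num.max (2 * h + 1) (y0 * b)).
  by rewrite lt_max; apply/orP; left; lra.
move=> x; rewrite ge_max => /andP[xh xb].
have x0 : 0 <= x by lra.
have tB : tail V ((x - h) / d) <= tail V (x / d0).
  apply: le_tail; rewrite (_ : x / d0 = x / 2 / (d0 / 2)); last first.
    by field; rewrite gt_eqF.
  apply: ler_pM; first by lra.
  - by rewrite invr_ge0 ltW// divr_gt0.
  - by lra.
  - by rewrite lef_pV2 ?posrE// divr_gt0.
have t0 y : 0 <= tail V y by exact: tail_ge0.
apply: (@le_trans _ _ (\int[m]_z ((1 + e / 2)%:E * (tail V (x / Theta z))%:E +
    (tail V ((x - h) / d))%:E * (\1_B z)%:E))%E).
  apply: ge0_le_integral => //.
  - by move=> z _; rewrite lee_fin.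
  - exact: measurable_scaled_tail.
  - apply: emeasurable_funD.
      by apply: measurable_funeM; exact: measurable_scaled_tail.
    apply: measurable_funeM; apply/measurable_EFinP; exact: measurable_indic.
  move=> z _; rewrite -!EFinM -EFinD lee_fin.
  have [zd|dz] := ltP (Theta z) d.
    rewrite indicE mem_set// mulr1.
    apply: (@le_trans _ _ (tail V ((x - h) / d))).
      rewrite le_tail// ler_wpM2l//; first by lra.
      by rewrite lef_pV2 ?posrE// ltW.
    by rewrite lerDr mulr_ge0//; lra.
  rewrite indicE memNset ?mulr0 ?addr0; last by rewrite /B/= ltNge dz.
  apply: (le_trans _ (y0P (x / Theta z) _)).
    rewrite le_tail// mulrBl lerD2l lerN2 ler_wpM2l//.
    by rewrite lef_pV2 ?posrE.
  rewrite ler_pdivlMr//; apply: le_trans xb.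
  by rewrite ler_wpM2l// ltW.
rewrite ge0_integralD//; first last.
- by apply: measurable_funeM; apply/measurable_EFinP; exact: measurable_indic.
- by move=> z _; rewrite -EFinM lee_fin mulr_ge0.
- by apply: measurable_funeM; exact: measurable_scaled_tail.
- by move=> z _; rewrite -EFinM lee_fin mulr_ge0//; lra.
rewrite ge0_integralZl_EFin//; first last.
- by lra.
- exact: measurable_scaled_tail.
- by move=> z _; rewrite lee_fin.
rewrite ge0_integralZl_EFin//; last by apply/measurable_EFinP; exact: measurable_indic.
rewrite integral_indic// setIT -/(mixed_tail x).
apply: (@le_trans _ _ ((1 + e / 2)%:E * mixed_tail x + (e / 2)%:E * mixed_tail x)%E).
  rewrite leeD2l//; apply: (@le_trans _ _
      ((tail V (x / d0))%:E * (e / 2 * fine (m A))%:E)%E).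
    by apply: lee_pmul => //; rewrite lee_fin.
  rewrite EFinM kE muleCA lee_pmul2l ?lte_fin//.
  exact: mixed_tail_ge.
rewrite -muleDl ?mixed_tail_fin_num// -EFinD.
by rewrite (_ : 1 + e / 2 + e / 2 = 1 + e)//; lra.
Qed.

End randomly_scaled_tail.

(** * Weighted sums of independent copies *)

Section finite_covers.
Context {disp : measure_display} {T : measurableType disp} {R : realType}
  (P : probability T R) {I : eqType}.

Lemma measurable_exists_seq (s : seq I) (B : I -> set T) :
  (forall i, measurable (B i)) -> measurable [set w | exists2 i, i \in s & B i w].
Proof.
move=> mB; elim: s => [|k s IH].
  by rewrite (_ : [set w | _] = set0)//; apply/seteqP; split => // w [].
rewrite (_ : [set w | _] = B k `|` [set w | exists2 i, i \in s & B i w]).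
  exact: measurableU.
apply/seteqP; split => w /=.
  move=> [i]; rewrite inE => /orP[/eqP ->|si] Bi; first by left.
  by right; exists i.
by move=> [Bk|[i si Bi]]; [exists k => //; rewrite mem_head|exists i => //; rewrite inE si orbT].
Qed.

Lemma probability_cover_le (s : seq I) (A : set T) (B : I -> set T) :
  measurable A -> (forall i, measurable (B i)) ->
  (forall w, A w -> exists2 i, i \in s & B i w) ->
  fine (P A) <= \sum_(i <- s) fine (P (B i)).
Proof.
elim: s A => [|k s IH] A mA mB AB.
  by rewrite big_nil (_ : A = set0) ?measure0//; apply/seteqP; split => // w /AB[].
have mAk : measurable (A `\` B k) by exact: measurableD.
apply: (@le_trans _ _ (fine (P (B k `|` (A `\` B k))))).
  apply: fine_probability_le => //; first exact: measurableU.
  by move=> w Aw; have [?|?] := pselect (B k w); [left|right].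
rewrite big_cons (le_trans (fine_probabilityU_le _ _ _))// lerD2l.
apply: IH => // w [/AB[i]]; rewrite inE => /orP[/eqP -> //|si Bi _].
by exists i.
Qed.

End finite_covers.

Lemma sumr_cst_seq (R : pzRingType) (I : Type) (s : seq I) (c : R) :
  \sum_(i <- s) c = (size s)%:R * c.
Proof. by rewrite big_const_seq count_predT iter_addr_0 mulr_natl. Qed.

Lemma seq_argmax (R : realDomainType) (I : eqType) (s : seq I) (f : I -> R) :
  s != [::] -> exists2 j, j \in s & forall i, i \in s -> f i <= f j.
Proof.
elim: s => // k [|k' s] IH _.
  by exists k; [rewrite mem_head|move=> i; rewrite inE => /eqP ->].
have [//|j js jP] := IH; have [fkj|/ltW fjk] := leP (f k) (f j).
  exists j; first by rewrite inE js orbT.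
  by move=> i; rewrite inE => /orP[/eqP ->//|/jP].
exists k; first by rewrite mem_head.
by move=> i; rewrite inE => /orP[/eqP ->//|/jP/le_trans]; apply.
Qed.

Section independent_sums.
Context {disp : measure_display} {T : measurableType disp} {R : realType}
  (P : probability T R) (V : probability R R) (Y : nat -> {RV P >-> R}).
Hypotheses (Y_ge0 : forall i w, 0 <= Y i w)
  (Y_law : forall i B, measurable B -> P (Y i @^-1` B) = V B)
  (Y_indep : mutual_independence P (fun i => g_sigma_algebra_preimage (Y i))).

Let measurable_Y i : measurable_fun setT (Y i).
Proof. exact: measurable_funP. Qed.

Let preimageY i (B : set R) : measurable B ->
  g_sigma_algebra_preimage (Y i) (Y i @^-1` B).
Proof. by move=> mB; exists B => //; rewrite setTI. Qed.

Let measurable_sumY (s : seq nat) : measurable_fun setT (fun w => \sum_(i <- s) Y i w).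
Proof. by apply: measurable_sum => i. Qed.

(** The induction moves one summand at a time out of the sum and into the
    intersection, which is why the statement carries the events [E i]. *)
Lemma law_event_sum (s : seq nat) (J : {fset nat}) (E : nat -> set T)
    (B : set R) : uniq s -> (forall i, i \in s -> i \notin J) ->
  (forall i, i \in J -> g_sigma_algebra_preimage (Y i) (E i)) -> measurable B ->
  P (\bigcap_(i in [set` J]) E i `&` [set w | B (\sum_(i <- s) Y i w)]) =
  (P (\bigcap_(i in [set` J]) E i) * convolution_pow V (size s) B)%E.
Proof.
elim: s J E B => [|k s IH] J E B.
  move=> _ _ _ mB; rewrite (_ : [set w | _] = [set w : T | B 0]); last first.
    by apply/funext => w; rewrite /mkset big_nil.
  rewrite /= /dirac indicE; have [B0|B0] := pselect (B 0).
    have -> : [set w : T | B 0] = setT by apply/seteqP; split.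
    by rewrite mem_set// mule1 setIT.
  have -> : [set w : T | B 0] = set0 by apply/seteqP; split.
  by rewrite memNset// mule0 setI0 measure0.
move=> /= /andP[ks us] sJ JE mB; set D := \bigcap_(i in _) _.
have mE i : i \in J -> measurable (E i).
  by move=> /JE[C mC <-]; exact: measurable_Y.
have mD : measurable D.
  by apply: fin_bigcap_measurable => // i /= /mE.
have kJ : k \notin J by apply: sJ; rewrite mem_head.
have -> : [set w | B (\sum_(i <- k :: s) Y i w)] =
    [set w | (@addp R @^-1` B) (Y k w, \sum_(i <- s) Y i w)].
  by apply/funext => w; rewrite /mkset big_cons.
apply: restricted_product_law => //; last first.
  by rewrite -[X in measurable X]setTI; exact: measurable_addp.
move=> A C mA mC.
pose E' i := if i == k then Y k @^-1` A else E i.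
pose J' := (k |` J)%fset.
have E'k i : i \in J -> E' i = E i.
  by rewrite /E' => iJ; case: eqP => // ik; move: kJ; rewrite -ik iJ.
have D' : \bigcap_(i in [set` J']) E' i = D `&` Y k @^-1` A.
  apply/seteqP; split => w /=.
    move=> H; split.
      by move=> i /= iJ; rewrite -E'k//; apply: H; rewrite /J' /= in_fset1U iJ orbT.
    by have := H k; rewrite /E' eqxx; apply; rewrite /J' /= fset1U1.
  move=> [Dw Aw] i; rewrite /J' /= in_fset1U => /orP[/eqP ->|iJ].
    by rewrite /E' eqxx.
  by rewrite E'k//; exact: Dw.
have J'E i : i \in J' -> g_sigma_algebra_preimage (Y i) (E' i).
  rewrite /J' in_fset1U => /orP[/eqP ->|iJ]; last by rewrite E'k//; exact: JE.
  by rewrite /E' eqxx; exact: preimageY.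
rewrite setIA -D' IH//; last first.
  move=> i si; rewrite /J' in_fset1U negb_or sJ ?andbT.
    by apply: contraNneq ks => <-.
  by rewrite inE si orbT.
rewrite muleA; congr (_ * _)%E.
rewrite Y_indep// Y_indep// big_fsetU1//=; rewrite muleC; congr (_ * _)%E.
  by apply: eq_big_seq => i iJ; rewrite E'k.
by rewrite /E' eqxx Y_law.
Qed.

Lemma law_sum (s : seq nat) (B : set R) : uniq s -> measurable B ->
  P [set w | B (\sum_(i <- s) Y i w)] = convolution_pow V (size s) B.
Proof.
move=> us mB; have := @law_event_sum s fset0 (fun=> setT) B us.
have -> : \bigcap_(i in [set` fset0 : {fset nat}]) [set: T] = setT.
  by apply/seteqP; split.
by rewrite probability_setT mul1e setTI; apply.
Qed.

Lemma law_pair_sum (k : nat) (s : seq nat) (S : set (R * R)) : uniq (k :: s) ->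
  measurable S -> P [set w | S (Y k w, \sum_(i <- s) Y i w)] =
  (V \x convolution_pow V (size s))%E S.
Proof.
move=> /= /andP[ks us] mS.
have := @restricted_product_law _ _ _ _ _ _ _ P V
  (convolution_pow V (size s)) setT (Y k) (fun w => \sum_(i <- s) Y i w)
  measurableT (measurable_Y k) (measurable_sumY s).
move=> /(_ _ S mS); rewrite setTI probability_setT mul1e; apply=> A B mA mB.
have := @law_event_sum s [fset k]%fset (fun=> Y k @^-1` A) B us.
have -> : \bigcap_(i in [set` [fset k]%fset]) Y k @^-1` A = Y k @^-1` A.
  apply/seteqP; split => w /=; first by apply; rewrite /= in_fset1.
  by move=> Aw i.
rewrite Y_law// mul1e setTI; apply => //.
- by move=> i si; rewrite in_fset1; apply: contraNneq ks => <-.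
- by move=> i; rewrite in_fset1 => /eqP ->; exact: preimageY.
Qed.

Lemma law_pair (i j : nat) (A B : set R) : i != j ->
  measurable A -> measurable B ->
  P (Y i @^-1` A `&` Y j @^-1` B) = (V A * V B)%E.
Proof.
move=> ij mA mB; have := @law_pair_sum i [:: j] (A `*` [set x | B x]).
have -> : [set w | (A `*` [set x | B x]) (Y i w, \sum_(i <- [:: j]) Y i w)] =
    Y i @^-1` A `&` Y j @^-1` B.
  by apply/funext => w; rewrite /mkset big_seq1.
move=> -> //; [|by rewrite /= inE ij|exact: measurableX].
rewrite [LHS](product_measure1E V (convolution_pow V 1) mA mB).
congr (_ * _)%E; apply: etrans (Y_law j mB).
apply: etrans (esym (@law_sum [:: j] B isT mB)) _; congr (P _).
by apply/funext => w; rewrite /mkset big_seq1.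
Qed.

Section weighted.
Context (theta : nat -> R) (b : R).
Hypotheses (theta_gt0 : forall i, 0 < theta i) (theta_le : forall i, theta i <= b).

Let tailY i x : fine (P [set w | x < theta i * Y i w]) = tail V (x / theta i).
Proof.
rewrite /tail -(Y_law i)//; congr (fine (P _)); apply/funext => w.
by rewrite /mkset/= in_itv/= andbT ltr_pdivrMr// mulrC.
Qed.

Let measurable_exceed i x : measurable [set w | x < theta i * Y i w].
Proof.
by apply: measurable_gt; exact: measurable_funM.
Qed.

(** Bonferroni's inequality; the events are independent and each has
    probability at most [tail V (x / b)]. *)
Lemma weighted_max_ge (s : seq nat) x : uniq s -> 0 <= x ->
  (1 - (size s)%:R * tail V (x / b)) * \sum_(i <- s) tail V (x / theta i) <=
  fine (P [set w | exists2 i, i \in s & x < theta i * Y i w]).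
Proof.
move=> us x0; set q := tail V (x / b).
pose B i := [set w | x < theta i * Y i w].
have mU (r : seq nat) : measurable [set w | exists2 i, i \in r & B i w].
  by apply: measurable_exists_seq => i; exact: measurable_exceed.
have mB i : measurable (B i) by exact: measurable_exceed.
suff : (1 - (size s)%:R * q) * \sum_(i <- s) fine (P (B i)) <=
    fine (P [set w | exists2 i, i \in s & B i w]).
  by under eq_bigr do rewrite tailY.
have q0 : 0 <= q by exact: tail_ge0.
elim: s us => [|k s IH] /=; first by rewrite big_nil mulr0 fine_probability_ge0.
move=> /andP[ks us]; have {}IH := IH us.
set p := fun i => fine (P (B i)) in IH *.
have p0 i : 0 <= p i by exact: fine_probability_ge0.
have b0 : 0 < b := lt_le_trans (theta_gt0 0) (theta_le 0).
have pq i : p i <= q.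
  by rewrite /p tailY le_tail// ler_wpM2l// lef_pV2 ?posrE.
set U := [set w | exists2 i, i \in s & B i w] in IH.
have mUs : measurable U by exact: mU.
have UE : [set w | exists2 i, i \in k :: s & B i w] = U `|` (B k `\` U).
  apply/seteqP; split => w /=.
    move=> [i]; rewrite inE => /orP[/eqP ->|si] Bi; last by left; exists i.
    by have [Uw|Uw] := pselect (U w); [left|right].
  move=> [[i si Bi]|[Bk _]]; last by exists k => //; rewrite mem_head.
  by exists i => //; rewrite inE si orbT.
have pk : p k = fine (P (B k `\` U)) + fine (P (B k `&` U)).
  have mD : measurable (B k `\` U) by exact: measurableD.
  have mI : measurable (B k `&` U) by exact: measurableI.
  have DI : (B k `\` U) `&` (B k `&` U) = set0.
    by apply/seteqP; split => // w [[_ nU] [_ /nU]].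
  apply: etrans (fine_probabilityU P mD mI DI).
  by rewrite /p setUC setUIDK.
have BkU : fine (P (B k `&` U)) <= (size s)%:R * q * p k.
  have : fine (P (B k `&` U)) <= \sum_(i <- s) fine (P (B k `&` B i)).
    apply: probability_cover_le.
    - exact: measurableI.
    - by move=> i; exact: measurableI.
    - by move=> w [Bk [i si Bi]]; exists i.
  move=> /le_trans; apply; rewrite -mulrA -sumr_cst_seq.
  rewrite big_seq [leRHS]big_seq; apply: ler_sum => i si.
  have -> : fine (P (B k `&` B i)) = p k * p i.
    have Bpre j : B j = Y j @^-1` `]x / theta j, +oo[.
      by apply/funext => w; rewrite /B /mkset/= in_itv/= andbT ltr_pdivrMr// mulrC.
    rewrite /p !Bpre law_pair//; last by apply: contraNneq ks => ->.
    by rewrite !Y_law// fineM// fin_num_measure.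
  by rewrite mulrC ler_wpM2r.
have mD : measurable (B k `\` U) by exact: measurableD.
have DU : U `&` (B k `\` U) = set0.
  by apply/seteqP; split => // w [Uw [_ /(_ Uw)]].
rewrite UE (fine_probabilityU P (mU s) mD DU).
rewrite big_cons -[(size s).+1%:R]natr1.
have sp : 0 <= \sum_(j <- s) p j by rewrite sumr_ge0.
have : 0 <= q * (p k + \sum_(j <- s) p j) by rewrite mulr_ge0// addr_ge0.
by move: IH pk BkU; rewrite -/(p k); lra.
Qed.

(** All weights are at most the largest one, so a weighted sum exceeds [x] only
    if the unweighted one exceeds [x] over the largest weight. *)
Lemma weighted_sum_geometric_bound (r : R) (s : seq nat) x : uniq s ->
  0 <= x -> 0 <= r ->
  (forall n x, 0 <= x -> tail (convolution_pow V n) x <= r ^+ n * tail V x) ->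
  fine (P [set w | x < \sum_(i <- s) theta i * Y i w]) <=
  r ^+ size s * \sum_(i <- s) tail V (x / theta i).
Proof.
move=> us x0 r0 H; have [->|s0] := eqVneq s [::].
  rewrite big_nil mulr0 (_ : [set w | _] = set0) ?measure0//.
  by apply/seteqP; split => // w /=; rewrite big_nil ltNge x0.
have [j js jmax] := seq_argmax theta s0.
apply: (@le_trans _ _ (tail (convolution_pow V (size s)) (x / theta j))).
  rewrite /tail -(law_sum us)//; apply: fine_probability_le.
  - by apply: measurable_gt; apply: measurable_sum => i; exact: measurable_funM.
  - have := measurable_sumY s measurableT (measurable_itv `]x / theta j, +oo[).
    by rewrite setTI.
  move=> w /=; rewrite in_itv/= andbT ltr_pdivrMr// => /lt_le_trans; apply.
  rewrite mulrC mulr_sumr big_seq [leRHS]big_seq; apply: ler_sum => i si.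
  by rewrite ler_wpM2r// jmax.
rewrite (le_trans (H _ _ _)) ?divr_ge0 ?(ltW (theta_gt0 _))//.
rewrite ler_wpM2l ?exprn_ge0// (big_rem j)//= lerDl sumr_ge0// => i _.
exact: tail_ge0.
Qed.

(** A sum above [x] none of whose terms exceeds [x - h * b] splits into its largest
    term and a remainder, both large; the event left over compares the two
    unweighted parts, so the estimate is uniform in the weights. *)
Lemma weighted_sum_le (s : seq nat) (h x e : R) : uniq s -> 0 < h -> 0 <= x ->
  0 <= e -> (size s)%:R * (h * b) <= x ->
  (forall y, x / b <= y -> fine ((V \x convolution_pow V (size s).-1)%E
      [set p : R * R | [/\ h < p.1, h < p.2 & y < p.1 + p.2]]) <=
      e * tail V y) ->
  fine (P [set w | x < \sum_(i <- s) theta i * Y i w]) <=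
  \sum_(i <- s) tail V ((x - h * b) / theta i) +
  (size s)%:R * e * \sum_(i <- s) tail V (x / theta i).
Proof.
move=> us h0 x0 e0 hx H; have [->|s0] := eqVneq s [::].
  rewrite !big_nil mulr0 addr0 (_ : [set w | _] = set0) ?measure0//.
  by apply/seteqP; split => // w /=; rewrite big_nil ltNge x0.
have n0 : 0 < (size s)%:R :> R by rewrite ltr0n lt0n size_eq0.
have b0 : 0 < b := lt_le_trans (theta_gt0 0) (theta_le 0).
have [k ks kmax] := seq_argmax theta s0.
pose y := x / theta k.
have xy : x / b <= y by rewrite ler_wpM2l// lef_pV2 ?posrE.
pose A j := [set w | x - h * b < theta j * Y j w].
pose C := [set p : R * R | [/\ h < p.1, h < p.2 & y < p.1 + p.2]].
have mC : measurable C.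
  have -> : C = (`]h, +oo[ `*` `]h, +oo[) `&` [set p : R * R | y < p.1 + p.2].
    apply/seteqP; split => -[u v]; rewrite /C /= !in_itv/= !andbT.
      by move=> [].
    by move=> [[]].
  by apply: measurableI; [exact: measurableX|exact: measurable_add_gt].
pose M j := [set w | C (Y j w, \sum_(i <- rem j s) Y i w)].
have mM j : measurable (M j).
  have mf : measurable_fun setT (fun w => (Y j w, \sum_(i <- rem j s) Y i w)).
    exact: measurable_fun_pair.
  by have := mf measurableT _ mC; rewrite setTI.
have mS : measurable [set w | x < \sum_(i <- s) theta i * Y i w].
  by apply: measurable_gt; apply: measurable_sum => i; exact: measurable_funM.
have mA j : measurable (A j) by exact: measurable_exceed.
have cover w : x < \sum_(i <- s) theta i * Y i w ->
    exists2 j, j \in s & (A j `|` M j) w.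
  move=> xS; have [j js jmax] := seq_argmax (fun i => theta i * Y i w) s0.
  exists j => //; have [Aj|nAj] := ltP (x - h * b) (theta j * Y j w); [by left|right].
  have SE : \sum_(i <- s) theta i * Y i w =
      theta j * Y j w + \sum_(i <- rem j s) theta i * Y i w.
    by rewrite (big_rem j).
  have Sn : \sum_(i <- s) theta i * Y i w <= (size s)%:R * (theta j * Y j w).
    rewrite -sumr_cst_seq big_seq [leRHS]big_seq.
    by apply: ler_sum => i si; exact: jmax.
  have tb : theta j * Y j w <= Y j w * b by rewrite mulrC ler_wpM2l.
  have rb : \sum_(i <- rem j s) theta i * Y i w <= (\sum_(i <- rem j s) Y i w) * b.
    by rewrite mulr_suml; apply: ler_sum => i _; rewrite mulrC ler_wpM2l.
  split => /=.
  - rewrite -(ltr_pM2r b0) (lt_le_trans _ tb)// -(ltr_pM2l n0).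
    by rewrite (le_lt_trans hx)// (lt_le_trans xS).
  - by rewrite -(ltr_pM2r b0) (lt_le_trans _ rb)//; move: xS; rewrite SE; lra.
  - rewrite /y ltr_pdivrMr//; apply: (lt_le_trans xS).
    have -> : Y j w + \sum_(i <- rem j s) Y i w = \sum_(i <- s) Y i w.
      by rewrite [RHS](big_rem j).
    rewrite mulr_suml big_seq [leRHS]big_seq; apply: ler_sum => i si.
    by rewrite mulrC ler_wpM2l// kmax.
have mAM j : measurable (A j `|` M j) by exact: measurableU.
apply: (le_trans (probability_cover_le P mS mAM cover)).
apply: (@le_trans _ _ (\sum_(j <- s) (tail V ((x - h * b) / theta j) +
    e * tail V y))).
  rewrite big_seq [leRHS]big_seq; apply: ler_sum => j js.
  rewrite (le_trans (fine_probabilityU_le _ _ _))// tailY lerD2l.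
  apply: le_trans (H y xy); rewrite -/C.
  have -> : M j = [set w | C (Y j w, \sum_(i <- rem j s) Y i w)] by [].
  rewrite law_pair_sum ?size_rem//.
  by rewrite -(perm_uniq (perm_to_rem js)).
rewrite big_split/= lerD2l sumr_cst_seq mulrA ler_wpM2l ?mulr_ge0//.
rewrite (big_rem k)//= lerDl sumr_ge0// => i _.
exact: tail_ge0.
Qed.

End weighted.
End independent_sums.

(** * Weighted sums of random vectors *)

Section vector_sums.
Context {disp : measure_display} {T : measurableType disp} {R : realType}
  {d : nat} (A : rare_set R d) (P : probability T R)
  (F : probability (borel_rV R d) R) (X : nat -> {RV P >-> borel_rV R d}).
Hypotheses (X_ge0 : forall i w, nneg_rV (X i w))
  (X_distr : forall i B, measurable B -> distribution P (X i) B = F B)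
  (X_indep : mutual_independence P (fun i => g_sigma_algebra_preimage (X i)))
  (F_subexp : subexponential_on A F).

Local Notation V := (distribution F (exit_level A)).

Let Y i : {RV P >-> R} := [the {mfun _ >-> _} of exit_level A \o X i].

Let Y_law i B : measurable B -> P (Y i @^-1` B) = V B.
Proof.
move=> mB; have mE : measurable (exit_level A @^-1` B).
  by have := measurable_exit_level A measurableT mB; rewrite setTI.
exact: X_distr.
Qed.

Let Y_indep : mutual_independence P (fun i => g_sigma_algebra_preimage (Y i)).
Proof.
move=> J E JE; apply: X_indep => i /JE[B mB <-].
exists (exit_level A @^-1` B) => //.
by have := measurable_exit_level A measurableT mB; rewrite setTI.
Qed.

Let Y_ge0 i w : 0 <= Y i w. Proof. exact: exit_level_ge0. Qed.

Definition sum_exceeds (theta : nat -> R) (s : seq nat) (x : R) : set T :=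
  [set w | x < exit_level A (\sum_(i <- s) theta i *: (X i w : 'rV[R]_d))].

Lemma measurable_sum_exceeds theta s x : measurable (sum_exceeds theta s x).
Proof.
apply: (@measurable_weighted_exceeds _ _ _ _ A (fun i _ => theta i) X) => i _.
  exact: measurable_cst.
exact: measurable_funP.
Qed.

Let sum_exceeds_le theta s x : (forall i, 0 < theta i) ->
  sum_exceeds theta s x `<=` [set w | x < \sum_(i <- s) theta i * Y i w].
Proof. by move=> t0 w /lt_le_trans; apply; exact: exit_level_sum_le. Qed.

Let measurable_sumY_exceeds theta (s : seq nat) x :
  measurable [set w | x < \sum_(i <- s) theta i * Y i w].
Proof.
by apply: measurable_gt; apply: measurable_sum => i; exact: measurable_funM.
Qed.

(** The summands lie in the nonnegative orthant and [A] is increasing, so one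
    large weighted summand suffices. *)
Lemma sum_exceeds_ge (theta : nat -> R) (b : R) (s : seq nat) (x : R) :
  (forall i, 0 < theta i) -> (forall i, theta i <= b) -> uniq s -> 0 <= x ->
  (1 - (size s)%:R * tail V (x / b)) * \sum_(i <- s) tail V (x / theta i) <=
  fine (P (sum_exceeds theta s x)).
Proof.
move=> t0 tb us x0; have b0 : 0 < b := lt_le_trans (t0 0) (tb 0).
apply: le_trans (weighted_max_ge Y_law Y_indep t0 tb us x0) _.
apply: fine_probability_le.
- apply: measurable_exists_seq => i.
  by have := measurable_sumY_exceeds theta [:: i] x; under eq_set do rewrite big_seq1.
- exact: measurable_sum_exceeds.
- move=> w [i si /lt_le_trans]; apply.
  exact: (@exit_level_sum_ge _ _ A _ s theta (fun i => X i w : 'rV[R]_d)).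
Qed.

Lemma sum_exceeds_geometric_bound : exists2 r : R, 1 <= r &
  forall (theta : nat -> R) (s : seq nat) (x : R),
  (forall i, 0 < theta i) -> uniq s -> 0 <= x ->
  fine (P (sum_exceeds theta s x)) <=
  r ^+ size s * \sum_(i <- s) tail V (x / theta i).
Proof.
have [r r1 rP] := subexponential_geometric_bound F_subexp; exists r => //.
move=> theta s x t0 us x0.
have r0 : 0 <= r by rewrite (le_trans ler01).
apply: le_trans (weighted_sum_geometric_bound Y_ge0 Y_law Y_indep t0 us x0 r0 rP).
by apply: fine_probability_le => //;
  [exact: measurable_sum_exceeds|exact: sum_exceeds_le].
Qed.

(** The threshold [x0] does not depend on the weights, whereas the shift [h]
    cannot be dropped: for weights close to 0 the tail of [V] may change
    noticeably between [(x - h) / theta i] and [x / theta i]. *)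
Lemma sum_exceeds_le_sum (n : nat) (b e : R) : 0 < b -> 0 < e ->
  exists2 h, 0 <= h & exists2 x0, 0 < x0 &
  forall (theta : nat -> R) (s : seq nat) (x : R),
  (forall i, 0 < theta i) -> (forall i, theta i <= b) ->
  uniq s -> size s = n -> x0 <= x ->
  fine (P (sum_exceeds theta s x)) <=
  \sum_(i <- s) tail V ((x - h) / theta i) +
  e * \sum_(i <- s) tail V (x / theta i).
Proof.
move=> b0 e0; have en0 : 0 < e / n.+1%:R by rewrite divr_gt0.
have [h h0 /near_pinftyP[y0 y00 y0P]] := subexponential_both_large F_subexp n.-1 en0.
exists (h * b); first by rewrite mulr_ge0// ltW.
exists (Num.max (y0 * b) (n%:R * (h * b))).
  by rewrite lt_max mulr_gt0.
move=> theta s x t0 tb us sn; rewrite ge_max => /andP[xy xh].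
have x0 : 0 <= x by rewrite (le_trans _ xh)// !mulr_ge0// ltW.
apply: (@le_trans _ _ (fine (P [set w | x < \sum_(i <- s) theta i * Y i w]))).
  by apply: fine_probability_le => //;
    [exact: measurable_sum_exceeds|exact: sum_exceeds_le].
apply: le_trans (weighted_sum_le (e := e / n.+1%:R) Y_ge0 Y_law Y_indep t0 tb
  us h0 x0 (ltW en0) _ _) _; first by rewrite sn.
  move=> y xby; rewrite sn; apply: y0P.
  by apply: le_trans xby; rewrite ler_pdivlMr.
rewrite lerD2l ler_wpM2r ?sumr_ge0// => [i _|]; first exact: tail_ge0.
by rewrite sn mulrCA ger_pMr// ler_pdivrMr// mul1r ler_nat.
Qed.

End vector_sums.

(** * Poisson arrivals and Campbell's formula *)

Lemma ge0_integral_mrestr {disp : measure_display} {T : measurableType disp}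
    {R : realType} (mu : {measure set T -> \bar R}) (D : set T)
    (mD : measurable D) (f : T -> \bar R) : measurable_fun setT f ->
  (forall x, (0 <= f x)%E) ->
  (\int[mrestr mu mD]_x f x = \int[mu]_(x in D) f x)%E.
Proof.
move=> mf f0; rewrite -(setUv D) ge0_integral_setU//; first last.
- by rewrite disj_set2E setICr.
- by rewrite setUv.
- exact: measurableC.
rewrite [X in (_ + X)%E](_ : _ = 0%E) ?adde0; last first.
  apply: null_set_integral => //; [exact: measurableC|exact: measurable_funTS|].
  by rewrite /= /mrestr setICl measure0.
apply: eq_measure_integral => A mA AD.
by rewrite /= /mrestr setIidl.
Qed.

Section poisson_sums.
Context {R : realType}.
Implicit Types a b lambda : R.

Lemma poisson_pmfE a k : 0 < a -> poisson_pmf a k = a ^+ k / k`!%:R * expR (- a).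
Proof. by move=> a0; rewrite /poisson_pmf a0. Qed.

(** The binomial theorem; in probabilistic terms, given that two independent
    Poisson variables add up to [n.+1], the first one has mean proportional to
    its parameter. *)
Lemma poisson_pmf_sum_mean a b n : 0 < a -> 0 < b ->
  \sum_(k < n.+2) k%:R * (poisson_pmf a k * poisson_pmf b (n.+1 - k)) =
  a * poisson_pmf (a + b) n.
Proof.
move=> a0 b0; have ab0 : 0 < a + b by rewrite addr_gt0.
rewrite big_ord_recl mul0r add0r poisson_pmfE// opprD expRD.
rewrite addrC exprDn mulr_suml mulr_suml mulr_sumr.
apply: eq_bigr => k _; rewrite !poisson_pmfE//= /bump/= add1n subSS.
have kn : (k <= n)%N by rewrite -ltnS.
have f0 m : (m`!%:R : R) != 0 by rewrite pnatr_eq0 -lt0n fact_gt0.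
have <- : (('C(n, k) * (k`! * (n - k)`!))%N%:R : R) = n`!%:R by rewrite bin_fact.
rewrite factS !natrM exprS -mulr_natr.
have c0 : ('C(n, k)%:R : R) != 0 by rewrite pnatr_eq0 -lt0n bin_gt0.
have k0 : (k.+1%:R : R) != 0 by rewrite pnatr_eq0.
have := f0 k; have := f0 (n - k)%N => h1 h2.
by field; rewrite h1 h2 c0 nat1r k0.
Qed.

Lemma poisson_pmf_series a : 0 < a -> series (poisson_pmf a) @ \oo --> (1 : R).
Proof.
move=> a0; have -> : series (poisson_pmf a) =
    fun n => series (exp_coeff a) n * expR (- a).
  apply/funext => n; rewrite /series/= mulr_suml; apply: eq_bigr => k _.
  by rewrite poisson_pmfE// exp_coeffE/= [_^-1 * _]mulrC.
rewrite -[X in _ --> X](@mulfV _ (expR a)) ?gt_eqF ?expR_gt0// -expRN.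
by apply: cvgM; [exact: is_cvg_series_exp_coeff|exact: cvg_cst].
Qed.

Lemma poisson_pmf_geometric_series a (r : R) : 0 < a -> 0 < r ->
  cvgn (series (fun n => r ^+ n * poisson_pmf a n)).
Proof.
move=> a0 r0; have -> : series (fun n => r ^+ n * poisson_pmf a n) =
    fun n => series (exp_coeff (r * a)) n * expR (- a).
  apply/funext => n; rewrite /series/= mulr_suml; apply: eq_bigr => k _.
  rewrite poisson_pmfE// exp_coeffE/= exprMn.
  by rewrite [_^-1 * _]mulrC !mulrA.
by apply: is_cvgM; [exact: is_cvg_series_exp_coeff|exact: is_cvg_cst].
Qed.

End poisson_sums.

Section arrivals.
Context {Z : Type} {R : realType} (N : R -> Z -> nat) (tau : nat -> Z -> R).
Hypothesis N_tau : arrival_times N tau.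

Lemma arrival_le i j w : (1 <= i)%N -> (i <= j)%N -> tau i w <= tau j w.
Proof.
case: N_tau => _ tauS _ i1; elim: j => [|j IH].
  by rewrite leqn0 => /eqP i0; rewrite i0 in i1.
rewrite leq_eqVlt => /predU1P[->//|]; rewrite ltnS => ij.
by rewrite (le_trans (IH ij))// ltW// tauS// (leq_trans i1).
Qed.

Lemma arrival_gt0 i w : (1 <= i)%N -> 0 < tau i w.
Proof.
move=> i1; case: N_tau => tau1 _ _.
by rewrite (lt_le_trans (tau1 w))// arrival_le.
Qed.

Lemma arrival_leP i t w : (1 <= i)%N -> 0 <= t -> (tau i w <= t) = (i <= N t w)%N.
Proof.
move=> i1 t0; case: N_tau => _ _ /(_ t w t0) NE; apply/idP/idP => [it|iN].
  rewrite -(ler_nat R) -lee_fin NE; apply: ereal_sup_ubound.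
  by right; exists i.
(* An integer above [i - 1/2] is at least [i], and it is not the 0 adjoined to
   the set of indices. *)
have : ((i%:R - 2^-1)%:E < (N t w)%:R%:E :> \bar R)%E.
  rewrite lte_fin; have : i%:R <= (N t w)%:R :> R by rewrite ler_nat.
  by lra.
rewrite NE => /ereal_sup_gt[_ [->|[n [n1 nt] <-]]]; rewrite lte_fin.
  have : 1 <= i%:R :> R by rewrite ler1n.
  by lra.
move=> ni; rewrite (le_trans _ nt)// arrival_le//.
rewrite -ltnS -(ltr_nat R) -natr1; lra.
Qed.

End arrivals.

Lemma measurable_arrival {disp : measure_display} {Z : measurableType disp}
    {R : realType} (N : R -> Z -> nat) (tau : nat -> Z -> R) i :
  arrival_times N tau -> (forall t, 0 <= t -> measurable_fun setT (N t)) ->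
  (1 <= i)%N -> measurable_fun setT (tau i).
Proof.
move=> N_tau mN i1 mT; apply: (measurability _ (RGenOInfty.measurableE R)) => //.
move=> _ [_ [t ->] <-]; rewrite setTI; have [t0|t0] := leP 0 t.
  have := mN t t0 mT [set k | (k < i)%N] I; rewrite setTI; congr measurable.
  apply/funext => w; rewrite /preimage/mkset/= in_itv/= andbT ltNge.
  by rewrite (arrival_leP N_tau)// -ltnNge.
rewrite (_ : _ @^-1` _ = setT)//; apply/seteqP; split => // w _ /=.
by rewrite in_itv/= andbT (lt_trans t0)// (arrival_gt0 N_tau).
Qed.

Lemma sum_partial_sums (R : pzRingType) (q : nat -> R) m :
  \sum_(k < m) \sum_(j < k.+1) q j = \sum_(j < m) (m - j)%:R * q j.
Proof.
elim: m => [|m IH]; first by rewrite !big_ord0.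
rewrite big_ord_recr/= IH [RHS]big_ord_recr/= subSnn mul1r.
rewrite big_ord_recr/= addrA -big_split/=; congr (_ + _).
by apply: eq_bigr => j _; rewrite subSn 1?ltnW// -natr1 mulrDl mul1r.
Qed.

Section campbell.
Context {disp : measure_display} {Omega : measurableType disp} {R : realType}
  (P : probability Omega R) (lambda : R) (N : R -> {RV P >-> nat})
  (tau : nat -> Omega -> R) (T : R).
Hypotheses (lambda_gt0 : 0 < lambda) (N_poisson : poisson_process lambda N)
  (N_tau : arrival_times N tau) (T_gt0 : 0 < T).

Let measurable_NE t k : measurable [set w | N t w = k].
Proof.
have mN : measurable_fun setT (N t) by exact: measurable_funP.
by have := mN measurableT [set k] I; rewrite setTI.
Qed.

Let measurable_tau i : (1 <= i)%N -> measurable_fun setT (tau i).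
Proof. by move=> i1; apply: (measurable_arrival N_tau) => // t _; exact: measurable_funP. Qed.

Lemma poisson_process_marginal t k : 0 < t ->
  P [set w | N t w = k] = (poisson_pmf (lambda * t) k)%:E.
Proof.
move=> t0; case: N_poisson => N0 /(_ 0 t k (lexx _) t0) + _; rewrite subr0 => <-.
by congr (P _); apply/funext => w; rewrite /mkset N0 add0n.
Qed.

Lemma poisson_process_joint t j k : 0 < t -> t < T ->
  P ([set w | N T w = (j + k)%N] `&` [set w | N t w = j]) =
  (poisson_pmf (lambda * t) j * poisson_pmf (lambda * (T - t)) k)%:E.
Proof.
move=> t0 tT; case: N_poisson => N0 incr indep.
(* Observing [N] at the times 0, [t], [T], [T], ... leaves two increments. *)
pose s i : R := if i is i'.+1 then (if i' is _.+1 then T else t) else 0.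
have s_nd : nondecreasing_seq s.
  apply/nondecreasing_seqP => -[|[|n]] //=; exact: ltW.
pose E i : set Omega := if i is _.+1 then [set w | N T w = (N t w + k)%N]
  else [set w | N t w = j].
have := indep s (lexx _) s_nd [fset 0; 1]%N%fset E.
rewrite big_fsetU1 ?in_fset1//= big_seq_fset1/= => H.
have -> : [set w | N T w = (j + k)%N] `&` [set w | N t w = j] =
    \bigcap_(i in [set` [fset 0; 1]%N%fset]) E i.
  apply/seteqP; split => w /=.
    move=> [NT Nt] i /=; rewrite in_fset2 => /orP[]/eqP -> //=.
    by rewrite NT Nt.
  move=> H01; have := H01 0%N; have := H01 1%N; rewrite /= !in_fset2/= => /(_ isT) h1 /(_ isT) h0.
  by rewrite h1 h0.
rewrite H.
  by rewrite poisson_process_marginal// incr ?(ltW t0)// EFinM.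
move=> i; rewrite in_fset2 => /orP[]/eqP -> /=.
  exists [set j%:R]; first exact: measurable_set1.
  rewrite setTI; apply/funext => w; rewrite /preimage/mkset/= N0 subr0.
  by apply/propext; split => [/eqP|->//]; rewrite eqr_nat => /eqP.
exists [set k%:R]; first exact: measurable_set1.
rewrite setTI; apply/funext => w; rewrite /preimage/mkset/=.
apply/propext; split => [/eqP|->]; last by rewrite natrD addrC addKr.
by rewrite subr_eq -natrD eqr_nat => /eqP ->; rewrite addnC.
Qed.

Let rays n t : (\sum_(k < n.+1)
    P ([set w | N T w = n.+1] `&` [set w | (t < tau k.+1 w)%R]) =
  (lambda * poisson_pmf (lambda * T) n)%:E *
    lebesgue_measure (`]t, +oo[ `&` `[0%R, T]%classic))%E.
Proof.
have lT0 : 0 < lambda * T by rewrite mulr_gt0.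
have [t0|t0] := leP t 0.
  under eq_bigr => k _.
    have -> : [set w | N T w = n.+1] `&` [set w | t < tau k.+1 w] =
        [set w | N T w = n.+1].
      by rewrite setIidl// => w _ /=; rewrite (le_lt_trans t0)// (arrival_gt0 N_tau).
    rewrite poisson_process_marginal//; over.
  rewrite sumEFin sumr_const card_ord.
  have -> : lebesgue_measure (`]t, +oo[ `&` `[0, T]%classic) = T%:E.
    have [->|tn0] := eqVneq t 0.
      rewrite (_ : _ `&` _ = `]0, T]%classic) ?lebesgue_measure_itv/= ?lte_fin ?T_gt0 ?oppr0 ?adde0//.
      apply/seteqP; split => u /=; rewrite !in_itv/= andbT.
        by move=> [-> /andP[_ ->]].
      by move=> /andP[u0 ->]; rewrite u0 ltW.
    rewrite (_ : _ `&` _ = `[0, T]%classic) ?lebesgue_measure_itv/= ?lte_fin ?T_gt0 ?oppr0 ?adde0//.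
    apply/seteqP; split => u /=; rewrite !in_itv/= andbT; first by case.
    move=> /andP[u0 uT]; split; last by rewrite u0.
    by rewrite (lt_le_trans _ u0)// lt_neqAle tn0.
  rewrite -EFinM !poisson_pmfE// factS natrM exprS; congr EFin.
  have k0 : (n.+1%:R : R) != 0 by rewrite pnatr_eq0.
  have f0 : (n`!%:R : R) != 0 by rewrite pnatr_eq0 -lt0n fact_gt0.
  by rewrite -mulr_natr; field; rewrite f0 nat1r k0.
have [Tt|tT] := leP T t.
  rewrite big1.
    rewrite (_ : _ `&` _ = set0) ?measure0 ?mule0//.
    apply/seteqP; split => // u [] /=; rewrite !in_itv/= andbT => tu /andP[_ uT].
    by move: (lt_le_trans tu (le_trans uT Tt)); rewrite ltxx.
  move=> k _; rewrite (_ : _ `&` _ = set0) ?measure0//.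
  apply/seteqP; split => // w [] /= NT; apply/negP; rewrite -leNgt.
  by rewrite (le_trans _ Tt)// (arrival_leP N_tau) ?NT// ltW.
(* [q j] is the probability of [j] arrivals up to [t] among [n.+1] up to [T]. *)
pose q j := poisson_pmf (lambda * t) j * poisson_pmf (lambda * (T - t)) (n.+1 - j).
pose D := [set w | N T w = n.+1].
have mD : measurable D by exact: measurable_NE.
have mlt m : measurable [set w | (N t w < m)%N].
  have mN : measurable_fun setT (N t) by exact: measurable_funP.
  by have := mN measurableT [set k | (k < m)%N] I; rewrite setTI.
have E m : (m <= n.+1)%N ->
    fine (P (D `&` [set w | (N t w < m)%N])) = \sum_(j < m) q j.
  elim: m => [_|m IH mn].
    rewrite big_ord0 (_ : _ `&` _ = set0) ?measure0//.
    by apply/seteqP; split => // w [].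
  rewrite big_ord_recr/= -IH ?(ltnW mn)//.
  have -> : q m = fine (P (D `&` [set w | N t w = m])).
    rewrite /D; have <- : (m + (n.+1 - m))%N = n.+1 by rewrite subnKC// ltnW.
    by rewrite poisson_process_joint// addKn.
  have mDlt : measurable (D `&` [set w | (N t w < m)%N]) by exact: measurableI.
  have mDeq : measurable (D `&` [set w | N t w = m]) by exact: measurableI.
  have dis : (D `&` [set w | (N t w < m)%N]) `&` (D `&` [set w | N t w = m]) = set0.
    by apply/seteqP; split => // w [] /= [_ +] [_ Nm]; rewrite Nm ltnn.
  apply: etrans (fine_probabilityU P mDlt mDeq dis); congr (fine (P _)).
  rewrite -setIUr; congr (_ `&` _); apply/funext => w; rewrite /setU/mkset/=.
  apply/propext; rewrite ltnS leq_eqVlt; split.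
    by move=> /predU1P[|]; [right|left].
  by move=> [->|->]; rewrite ?orbT ?eqxx.
under eq_bigr => k _.
  have -> : [set w | t < tau k.+1 w] = [set w | (N t w < k.+1)%N].
    apply/funext => w; rewrite /mkset ltNge (arrival_leP N_tau) ?(ltW t0)//.
    by rewrite -ltnNge.
  rewrite -fine_probabilityK ?E//; last exact: measurableI.
  over.
rewrite sumEFin sum_partial_sums.
have -> : lebesgue_measure (`]t, +oo[ `&` `[0, T]%classic) = (T - t)%:E.
  rewrite (_ : _ `&` _ = `]t, T]%classic).
    by rewrite lebesgue_measure_itv/= lte_fin tT EFinB.
  apply/seteqP; split => u /=; rewrite !in_itv/= andbT.
    by move=> [-> /andP[_ ->]].
  by move=> /andP[tu uT]; rewrite tu uT (ltW (lt_trans t0 tu)).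
rewrite -EFinM; congr EFin.
have a0 : 0 < lambda * t by rewrite mulr_gt0.
have b0 : 0 < lambda * (T - t) by rewrite mulr_gt0// subr_gt0.
have := poisson_pmf_sum_mean n b0 a0.
rewrite -mulrDr subrK mulrAC => <-.
rewrite [RHS](reindex_inj rev_ord_inj)/= [RHS]big_ord_recr/= subnn mul0r addr0.
apply: eq_bigr => j _; rewrite subSS [_ * poisson_pmf (lambda * t) _]mulrC.
by rewrite subKn// ltnW// ltnS.
Qed.

(** Campbell's formula for a functional that also records the number of points.
    Both sides are integrals of [g] against finite measures.  These are compared
    on the half-lines [`]t, +oo[], where only the joint law of [N t] and
    [N T - N t] matters. *)
Lemma campbell_formula n (g : R -> \bar R) : measurable_fun setT g ->
  (forall t, (0 <= g t)%E) ->
  (\sum_(k < n.+1) \int[P]_(w in [set w | N T w = n.+1]) g (tau k.+1 w) =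
  (lambda * poisson_pmf (lambda * T) n)%:E *
    \int[lebesgue_measure]_(t in `[0%R, T]%classic) g t)%E.
Proof.
move=> mg g0; pose D := [set w | N T w = n.+1].
have mD : measurable D by exact: measurable_NE.
have c0 : 0 <= lambda * poisson_pmf (lambda * T) n.
  by rewrite mulr_ge0 ?poisson_pmf_ge0 ?ltW.
have [m_ m_E] : exists m_ : {measure set (measurableTypeR R) -> \bar R}^nat, forall k B,
    m_ k B = P ([set w | N T w = n.+1] `&` [set w | B (tau k.+1 w)]).
  have : forall k, exists m : {measure set (measurableTypeR R) -> \bar R}, forall B,
      m B = P ([set w | N T w = n.+1] `&` [set w | B (tau k.+1 w)]).
    move=> k; unshelve eexists
      (pushforward (mrestr P mD) (tau k.+1 : Omega -> measurableTypeR R) :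
        {measure set _ -> \bar R}).
      exact: measurable_tau.
    by move=> B; rewrite /= /pushforward /mrestr setIC.
  by move=> /choice[m_ m_E]; exists m_.
have mI : measurable (`[0, T]%classic : set R) by exact: measurable_itv.
pose m1 : {measure set (measurableTypeR R) -> \bar R} := msum m_ n.+1.
pose m2 : {measure set (measurableTypeR R) -> \bar R} :=
  mscale (NngNum c0) (mrestr (@lebesgue_measure R) mI).
have m12 : forall B : set (measurableTypeR R), measurable B -> m1 B = m2 B.
  apply: (@measure_unique _ R (measurableTypeR R) [set B | exists t, B = `]t, +oo[%classic]
    (fun k => `](- k%:R), +oo[%classic)).
  - exact: RGenOInfty.measurableE.
  - move=> _ _ [s ->] [t ->]; exists (Num.max s t); apply/seteqP; split => u /=;
    by rewrite !in_itv/= !andbT gt_max => /andP.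
  - by move=> k; exists (- k%:R).
  - apply/seteqP; split => // u _; exists (Num.truncn `|u|).+1 => //=.
    rewrite in_itv/= andbT ltrNl (le_lt_trans (ler_norm _))// normrN.
    exact: truncnS_gt.
  - move=> _ [t ->]; rewrite /m1 /m2 /= /msum /mscale /mrestr/= -rays.
    apply: eq_bigr => k _; rewrite m_E; congr (P (_ `&` _)).
    by apply/funext => w; rewrite /mkset/= in_itv/= andbT.
  - move=> k; rewrite /m1 /= /msum; apply/lte_sum_pinfty => i _.
    rewrite m_E (le_lt_trans (probability_le1 _ _)) ?ltry//.
    apply: measurableI => //.
    have := measurable_tau (ltn0Sn i) measurableT (measurable_itv `]- k%:R, +oo[).
    by rewrite setTI.
transitivity (\int[m1]_t g t)%E.
  rewrite /m1 ge0_integral_measure_sum//; apply: eq_bigr => k _.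
  have mtau := measurable_tau (ltn0Sn k).
  have mgt : measurable_fun setT (g \o tau k.+1) by exact: measurableT_comp.
  have gt0 w : (0 <= (g \o tau k.+1) w)%E by exact: g0.
  transitivity (\int[mrestr P mD]_w (g \o tau k.+1) w)%E.
    by rewrite ge0_integral_mrestr.
  transitivity (\int[pushforward (mrestr P mD)
      (tau k.+1 : Omega -> measurableTypeR R)]_t g t)%E.
    by rewrite ge0_integral_pushforward.
  apply: eq_measure_integral => B mB _.
  by rewrite m_E /= /pushforward /mrestr setIC.
transitivity (\int[m2]_t g t)%E.
  by apply: eq_measure_integral => B mB _; exact: m12.
rewrite /m2 ge0_integral_mscale//.
by rewrite ge0_integral_mrestr.
Qed.

End campbell.

(** * Limits of series and generated sigma-algebras *)

(** Tannery's theorem: up to [e] the domination reduces the series to finitely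
    many terms, uniformly in [x]. *)
Lemma tannery (R : realType) (a : nat -> R -> R) (c u : nat -> R) (f : R -> R)
    (l : R) :
  (\forall x \near +oo, forall n, 0 <= a n x <= u n) ->
  (forall n, a n @ +oo --> c n) ->
  (\forall x \near +oo, (series (a ^~ x)) @ \oo --> f x) ->
  cvgn (series u) -> series c @ \oo --> l -> f @ +oo --> l.
Proof.
move=> au ac af cu cl; apply/cvgrPdist_le => e e0.
have e3 : 0 < e / 3 by rewrite divr_gt0.
set U := limn (series u).
have [M [MU Ml]] : exists M, `|U - series u M| <= e / 3 /\ `|l - series c M| <= e / 3.
  have /cvgrPdist_le/(_ _ e3)[M1 _ H1] := cu.
  have /cvgrPdist_le/(_ _ e3)[M2 _ H2] := cl.
  exists (maxn M1 M2); split; [apply: H1|apply: H2] => /=.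
    exact: leq_maxl.
  exact: leq_maxr.
have aM : (fun x => \sum_(0 <= i < M) a i x) @ +oo --> \sum_(0 <= i < M) c i.
  elim: (M) => [|m IH].
    by rewrite big_geq//; under eq_fun do rewrite big_geq//; exact: cvg_cst.
  rewrite big_nat_recr//=; under eq_fun do rewrite big_nat_recr//=.
  by apply: cvgD; [exact: IH|exact: ac].
have /cvgrPdist_le/(_ _ e3) aMe := aM.
near=> x.
have aux : forall n, 0 <= a n x <= u n by near: x.
have afx : series (a ^~ x) @ \oo --> f x by near: x.
have close : `|series c M - series (a ^~ x) M| <= e / 3 by near: x.
have lo : series (a ^~ x) M <= f x.
  have <- : limn (series (a ^~ x)) = f x by exact/cvg_lim.
  apply: nondecreasing_cvgn_le; last by apply/cvg_ex; exists (f x).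
  apply/nondecreasing_seqP => k; rewrite !seriesEnat/= big_nat_recr//= lerDl.
  by have /andP[] := aux k.
have hi : f x - series (a ^~ x) M <= U - series u M.
  have c1 : (fun k => series (a ^~ x) k - series (a ^~ x) M) @ \oo -->
      f x - series (a ^~ x) M by apply: cvgB => //; exact: cvg_cst.
  have c2 : (fun k => series u k - series u M) @ \oo --> U - series u M.
    by apply: cvgB => //; exact: cvg_cst.
  rewrite -(cvg_lim _ c1)// -(cvg_lim _ c2)//; apply: ler_lim.
  - by apply/cvg_ex; eexists; exact: c1.
  - by apply/cvg_ex; eexists; exact: c2.
  exists M => // k /= Mk; rewrite !seriesEnat/= !(big_cat_nat (leq0n M) Mk)/=.
  rewrite !(addrC (\sum_(0 <= i < M) _)) !addrK.
  by apply: ler_sum => i _; have /andP[] := aux i.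
have hU : U - series u M <= e / 3 by rewrite (le_trans (ler_norm _)).
move: Ml close; rewrite !ler_norml => /andP[? ?] /andP[? ?].
by apply/andP; split; lra.
Unshelve. all: by end_near. Qed.

Lemma eq_probability_off_null {disp : measure_display} {T : measurableType disp}
    {R : realType} (P : probability T R) (A B : set T) (Q : T -> Prop) :
  measurable A -> measurable B -> {ae P, forall w, Q w} ->
  (forall w, Q w -> A w <-> B w) -> P A = P B.
Proof.
move=> mA mB [Z [mZ PZ QZ]] AB.
have AZ w : ~ Z w -> A w <-> B w.
  by move=> nZ; apply: AB; apply: contrapT => nQ; apply: nZ; exact: QZ.
have le (C D : set T) : measurable C -> measurable D ->
    (forall w, ~ Z w -> C w -> D w) -> (P C <= P D)%E.
  move=> mC mD CD; apply: (@le_trans _ _ (P (D `|` Z))).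
    rewrite le_measure ?inE//; first exact: measurableU.
    by move=> w Cw; have [?|nZ] := pselect (Z w); [right|left; exact: CD].
  apply: (le_trans (measureU2 P mD mZ)).
  by rewrite [X in (_ + X <= _)%E]PZ adde0.
by apply/eqP; rewrite eq_le !le// => w /AZ[].
Qed.

Lemma sigma_algebra_setT (T : Type) (G : set (set T)) :
  sigma_algebra setT G -> G setT.
Proof. by move=> [G0 GC _]; rewrite -(setD0 setT); exact: GC. Qed.

Section generated_sigma_algebras.
Context {disp : measure_display} {T : measurableType disp} {R : realType}
  (P : probability T R).

Lemma measurable_id_generated (G : set (set T)) : G `<=` measurable ->
  measurable_fun setT (fun w : T => w : g_sigma_algebraType G).
Proof.
move=> mG mT B sB; rewrite setTI.
by apply: (smallest_sub _ mG) sB; exact: sigma_algebra_measurable.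
Qed.

Lemma process_sigma_measurable {d' : measure_display} {T' : measurableType d'}
    (I : Type) (D : set I) (X : I -> T -> T') :
  (forall i, D i -> measurable_fun setT (X i)) ->
  process_sigma D X `<=` measurable.
Proof.
move=> mX; apply: smallest_sub; first exact: sigma_algebra_measurable.
by move=> _ [i Di [B mB <-]]; exact: mX.
Qed.

Lemma process_sigma_sigma_algebra {d' : measure_display}
    {T' : measurableType d'} (I : Type) (D : set I) (X : I -> T -> T') :
  sigma_algebra setT (process_sigma D X).
Proof. exact: smallest_sigma_algebra. Qed.

Lemma measurable_process_sigma {d' : measure_display} {T' : measurableType d'}
    (I : Type) (D : set I) (X : I -> T -> T') i : D i ->
  measurable_fun setT (X i : g_sigma_algebraType (process_sigma D X) -> T').
Proof.
move=> Di mT B mB; rewrite setTI; apply: sub_sigma_algebra.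
apply: sub_sigma_algebra; exists i => //; exists B => //.
by rewrite setTI.
Qed.

Lemma null_augmentation_measurable (G : set (set T)) : G `<=` measurable ->
  null_augmentation P G `<=` measurable.
Proof.
move=> mG; apply: smallest_sub; first exact: sigma_algebra_measurable.
by move=> A [/mG//|[]].
Qed.

(** Null events are independent of everything, and together with a
    sigma-algebra they form a pi-system. *)
Lemma independent_of_null_augmentation (D : set T) (G : set (set T)) :
  measurable D -> sigma_algebra setT G -> G `<=` measurable ->
  (forall A, G A -> P (D `&` A) = P D * P A)%E ->
  forall A, null_augmentation P G A -> P (D `&` A) = (P D * P A)%E.
Proof.
move=> mD sG mG GP; apply: independent_of_generated => //.
- by move=> A [/mG//|[]].
- have PI0 A B : measurable A -> measurable B -> P B = 0%E -> P (A `&` B) = 0%E.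
    move=> mA mB B0; apply/eqP; rewrite eq_le measure_ge0 andbT -B0.
    by rewrite le_measure ?inE//; exact: measurableI.
  move=> A B [GA|[mA A0]] [GB|[mB B0]].
  + by left; rewrite -(measurable_g_measurableTypeE sG); apply: measurableI;
      rewrite measurable_g_measurableTypeE.
  + by right; split; [exact: measurableI (mG _ GA) mB|exact: PI0 (mG _ GA) mB B0].
  + right; split; first exact: measurableI mA (mG _ GB).
    by rewrite setIC; exact: PI0 (mG _ GB) mA A0.
  + by right; split; [exact: measurableI|exact: PI0].
- move=> A [/GP//|[mA A0]]; rewrite A0 mule0; apply/eqP.
  rewrite eq_le measure_ge0 andbT -A0 le_measure ?inE//; exact: measurableI.
Qed.

End generated_sigma_algebras.

(** * Compound sums over Poisson arrivals *)

Section compound_process.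
Context (R : realType) (d : nat) (A : rare_set R d)
  (disp : measure_display) (Omega : measurableType disp)
  (P : probability Omega R)
  (F : probability (borel_rV R d) R)
  (X : nat -> {RV P >-> borel_rV R d})
  (X_ge0 : forall i w, nneg_rV (X i w))
  (X_distr : forall i B, measurable B -> distribution P (X i) B = F B)
  (X_indep : mutual_independence P (fun i => g_sigma_algebra_preimage (X i)))
  (F_subexp : subexponential_on A F)
  (lambda : R) (lambda_gt0 : 0 < lambda)
  (N : R -> {RV P >-> nat}) (N_poisson : poisson_process lambda N)
  (tau : nat -> Omega -> R) (N_tau : arrival_times N tau)
  (Rt : R -> {RV P >-> R}) (Rt_meas : jointly_measurable P Rt)
  (XNR_indep : mutual_independence P (fun k : 'I_3 => nth set0
     [:: process_sigma setT X;
         process_sigma `[0, +oo[%classic N;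
         process_sigma `[0, +oo[%classic (fun t w => expR (Rt t w))] k))
  (T : R) (T_gt0 : 0 < T) (C : R)
  (Rt_gt : {ae P, forall w, forall t, 0 <= t -> t <= T -> - C < Rt t w}).

Let GX := process_sigma setT X.
Let GN := process_sigma `[0, +oo[%classic N.
Let G0 := process_sigma `[0, +oo[%classic Rt.
Let GR := null_augmentation P G0.

Let mGX : GX `<=` measurable.
Proof. by apply: process_sigma_measurable => i _; exact: measurable_funP. Qed.

Let mGN : GN `<=` measurable.
Proof. by apply: process_sigma_measurable => i _; exact: measurable_funP. Qed.

Let mG0 : G0 `<=` measurable.
Proof. by apply: process_sigma_measurable => i _; exact: measurable_funP. Qed.

Let mGR : GR `<=` measurable.
Proof. exact: null_augmentation_measurable. Qed.

Let sG0 : sigma_algebra setT G0.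
Proof. exact: process_sigma_sigma_algebra. Qed.

(** The hypothesis of independence speaks of [expR (Rt t)], which generates the
    same sigma-algebra as [Rt t] because [ln] undoes [expR]. *)
Let G0_exp : G0 `<=`
  process_sigma `[0, +oo[%classic (fun t w => expR (Rt t w)).
Proof.
apply: smallest_sub; first exact: process_sigma_sigma_algebra.
move=> _ [t t0 [B mB <-]]; apply: sub_sigma_algebra; exists t => //.
exists (@ln R @^-1` B).
  by have := @measurable_ln R measurableT _ mB; rewrite setTI.
by rewrite !setTI; apply/funext => w; rewrite /preimage/mkset expRK.
Qed.

Let triple_indep B1 B2 B3 : GN B1 -> G0 B2 -> GX B3 ->
  P (B3 `&` B1 `&` B2) = (P B3 * P B1 * P B2)%E.
Proof.
move=> GB1 /G0_exp GB2 GB3.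
pose k0 : 'I_3 := @Ordinal 3 0 isT; pose k1 : 'I_3 := @Ordinal 3 1 isT.
pose k2 : 'I_3 := @Ordinal 3 2 isT.
pose E (k : 'I_3) := nth set0 [:: B3; B1; B2] k.
have := XNR_indep (J := [fset k0; k1; k2]%fset) (E := E).
have -> : \bigcap_(i in [set` [fset k0; k1; k2]%fset]) E i = B3 `&` B1 `&` B2.
  apply/seteqP; split => w /=.
    move=> H; have := H k0; have := H k1; have := H k2.
    by rewrite /= !inE/= => /(_ isT) h2 /(_ isT) h1 /(_ isT) h0.
  move=> [[h3 h1] h2] k /=; rewrite !inE => /orP[/orP[]|] /eqP -> //.
rewrite -fsetUA !big_fsetU1/= ?big_seq_fset1 ?inE//= => ->; first by rewrite muleA.
by move=> i; rewrite !inE => /orP[|/orP[]] /eqP ->.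
Qed.

Let joint_indep B1 B2 B3 : GN B1 -> GR B2 -> GX B3 ->
  P (B3 `&` (B1 `&` B2)) = (P B3 * (P B1 * P B2))%E.
Proof.
move=> GB1 GB2 GB3.
have GNX : P (B3 `&` B1) = (P B3 * P B1)%E.
  have := triple_indep GB1 (sigma_algebra_setT sG0) GB3.
  by rewrite setIT probability_setT mule1.
rewrite setIA muleA -GNX.
apply: (independent_of_null_augmentation _ sG0) GB2 => //.
  by apply: measurableI; [exact: mGX|exact: mGN].
by move=> B GB; rewrite triple_indep// GNX.
Qed.

Local Notation OX := (g_sigma_algebraType GX).
Local Notation ON := (g_sigma_algebraType GN).
Local Notation OR := (g_sigma_algebraType GR).

Let idX : {mfun Omega >-> OX} := mfun_Sub (mem_set (measurable_id_generated mGX)).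
Let idN : {mfun Omega >-> ON} := mfun_Sub (mem_set (measurable_id_generated mGN)).
Let idR : {mfun Omega >-> OR} := mfun_Sub (mem_set (measurable_id_generated mGR)).
Let muX : probability OX R := distribution P idX.
Let muN : probability ON R := distribution P idN.
Let muR : probability OR R := distribution P idR.

(** Under the joint law the arrivals, the returns and the claims live on separate
    coordinates, so that Fubini's theorem applies. *)
Let joint_law (S : set ((ON * OR) * OX)) : measurable S ->
  P [set w | S ((w, w), w)] = ((muN \x muR) \x muX)%E S.
Proof.
move=> mS; apply: (law_of_independent_triple (f1 := idN) (f2 := idR) (f3 := idX)) => //.
move=> B1 B2 B3 mB1 mB2 mB3; apply: joint_indep.
- by move: mB1; rewrite measurable_g_measurableTypeE//; exact: smallest_sigma_algebra.
- by move: mB2; rewrite measurable_g_measurableTypeE//; exact: smallest_sigma_algebra.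
- by move: mB3; rewrite measurable_g_measurableTypeE//; exact: smallest_sigma_algebra.
Qed.

Let b := expR C.

(** The discount factor at time [p.1], truncated at its almost sure bound [b] on
    [[0, T]] so that it is bounded everywhere; negative times, about which joint
    measurability says nothing, are sent to 0. *)
Let Theta (p : R * OR) : R := Num.min b (expR (- Rt (Num.max p.1 0) p.2)).

Let Theta_gt0 p : 0 < Theta p.
Proof. by rewrite lt_min !expR_gt0. Qed.

Let Theta_le p : Theta p <= b.
Proof. by rewrite ge_min lexx. Qed.

Let measurable_R0 : measurable_fun setT (fun p : R * OR => Rt (Num.max p.1 0) p.2).
Proof.
have mD : measurable [set p : R * OR | 0 <= p.1].
  have := @measurable_fst _ _ R OR measurableT _ (measurable_itv `[0, +oo[).
  by rewrite setTI set_itvE.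
have mR : measurable_fun [set p : R * OR | 0 <= p.1]
    (fun p : R * OR => (Rt p.1 p.2 : R)) by exact: Rt_meas.
have mf : measurable_fun setT (fun p : R * OR => (Num.max p.1 0, p.2)).
  by apply: measurable_fun_pair => //; exact: measurable_maxr.
have mfR : [set (Num.max p.1 0, p.2) | p in [set: R * OR]] `<=` [set p : R * OR | 0 <= p.1].
  by move=> _ [p _ <-] /=; rewrite le_max lexx orbT.
have := measurable_comp mD mfR mR mf.
exact.
Qed.

Let measurable_Theta : measurable_fun setT Theta.
Proof.
apply: measurable_minr => //; apply: measurableT_comp => //.
exact: measurableT_comp.
Qed.

Let Theta_eq w t : (forall t, 0 <= t -> t <= T -> - C < Rt t w) -> 0 <= t -> t <= T ->
  Theta (t, w) = expR (- Rt t w).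
Proof.
move=> H t0 tT; rewrite /Theta/= max_l// min_r// ler_expR.
by rewrite lerNl ltW// H.
Qed.

Local Notation V := (distribution F (exit_level A)).

Let measurable_idR : measurable_fun setT (fun t : measurableTypeR R => t : R).
Proof. exact: measurable_id. Qed.

(** The uniform law on [[0, T]], carried over to [R] with its own Borel
    structure. *)
Let U : probability R R :=
  distribution (uniform_prob T_gt0) (mfun_Sub (mem_set measurable_idR)).

Let m : probability (R * OR)%type R := (U \x muR)%E.

Let H (x : R) : \bar R := mixed_tail V m Theta x.

Let G x (t : R) : \bar R := (\int[muR]_w (tail V (x / Theta (t, w)))%:E)%E.

Let measurable_tail_Theta x :
  measurable_fun setT (fun p : R * OR => (tail V (x / Theta p))%:E).
Proof. exact: measurable_scaled_tail. Qed.

Let measurable_G x : measurable_fun setT (G x).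
Proof.
apply: (measurable_fun_fubini_tonelli_F (fun p => (tail V (x / Theta p))%:E)) => //.
by move=> p; rewrite lee_fin tail_ge0.
Qed.

Let G_ge0 x t : (0 <= G x t)%E.
Proof. by apply: integral_ge0 => w _; rewrite lee_fin tail_ge0. Qed.

Let integral_G x : (\int[lebesgue_measure]_(t in `[0%R, T]%classic) G x t =
  T%:E * H x)%E.
Proof.
rewrite /H /mixed_tail fubini_tonelli1//; last by move=> p; rewrite lee_fin tail_ge0.
have := @integral_uniform R 0 T T_gt0 (G x) (measurable_G x) (G_ge0 x).
rewrite subr0 => E.
transitivity (T%:E * \int[U]_t G x t)%E => //.
rewrite ge0_integral_distribution// E muleA.
by rewrite -EFinM divff ?gt_eqF// mul1e.
Qed.

Let measurable_tauN i : (1 <= i)%N -> measurable_fun setT (tau i : ON -> R).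
Proof.
move=> i1; apply: (@measurable_arrival _ ON R (fun t => N t : ON -> nat)) => //.
move=> t t0; apply: measurable_process_sigma.
by rewrite /= in_itv/= andbT.
Qed.

Let D n : set ON := [set v | N T v = n].

Let mD n : measurable (D n).
Proof.
have mN : measurable_fun setT (N T : ON -> nat).
  by apply: measurable_process_sigma; rewrite /= in_itv/= andbT ltW.
by have := mN measurableT [set n] I; rewrite setTI.
Qed.

Let theta i (z : ON * OR) : R := Theta (tau i z.1, z.2).

Let measurable_theta i : (1 <= i)%N -> measurable_fun setT (theta i).
Proof.
move=> i1; apply: (measurableT_comp measurable_Theta).
apply: measurable_fun_pair => //.
by apply: measurableT_comp => //; exact: measurable_tauN.
Qed.

(** The expectation, on the event of [n] arrivals, of the sum of the tails of the
    single discounted claims. *)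
Let J n x : \bar R := (\int[muN \x muR]_z
  ((\1_(D n) z.1)%:E * (\sum_(1 <= i < n.+1) tail V (x / theta i z))%:E))%E.

(** Integrating out the returns turns each term into a function of one arrival
    time, and Campbell's formula averages it over [[0, T]].  Thus [J n.+1] depends
    on [n] only through a constant factor. *)
Let J_E n x : J n.+1 x = ((lambda * poisson_pmf (lambda * T) n * T)%:E * H x)%E.
Proof.
pose h k (z : ON * OR) := ((\1_(D n.+1) z.1)%:E * (tail V (x / theta k.+1 z))%:E)%E.
have h0 k z : (0 <= h k z)%E by rewrite mule_ge0// lee_fin tail_ge0.
have mh k : measurable_fun setT (h k).
  apply: emeasurable_funM.
    apply/measurable_EFinP.
    have mi : measurable_fun setT (\1_(D n.+1) : ON -> R) by exact: measurable_indic.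
    exact: (measurableT_comp mi measurable_fst).
  apply: measurable_scaled_tail; first exact: measurable_theta.
  by move=> z; exact: Theta_gt0.
transitivity (\sum_(k < n.+1) \int[muN \x muR]_z h k z)%E.
  rewrite /J -[in RHS](big_mkord xpredT (fun k => \int[muN \x muR]_z h k z)%E).
  rewrite -ge0_integral_sum//; apply: eq_integral => z _.
  rewrite -sumEFin big_add1/= big_mkord ge0_sume_distrr//.
    by rewrite -(big_mkord xpredT (fun k => h k z)).
  by move=> i _; rewrite lee_fin tail_ge0.
rewrite EFinM -muleA -integral_G.
rewrite -(campbell_formula lambda_gt0 N_poisson N_tau T_gt0 n (measurable_G x) (G_ge0 x)).
apply: eq_bigr => k _; rewrite fubini_tonelli1//.
have mGt : measurable_fun setT (fun v : ON => G x (tau k.+1 v)).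
  by apply: measurableT_comp => //; exact: measurable_tauN.
have mi : measurable_fun setT (\1_(D n.+1) : ON -> R) by exact: measurable_indic.
transitivity (\int[muN]_v ((\1_(D n.+1) v)%:E * G x (tau k.+1 v)))%E.
  apply: eq_integral => v _; rewrite /fubini_F /h/= ge0_integralZl_EFin//.
  - by move=> w _; rewrite lee_fin tail_ge0.
  - have mp : measurable_fun setT (fun w : OR => (tau k.+1 v, w)).
      exact: measurable_fun_pair.
    exact: (measurableT_comp (measurable_tail_Theta x) mp).
rewrite ge0_integral_distribution//; last 2 first.
- by apply: emeasurable_funM => //; exact/measurable_EFinP.
- by move=> v; rewrite mule_ge0// lee_fin.
rewrite [RHS]integral_mkcond; apply: eq_integral => w _ /=.
by rewrite patchE indicE /D; case: ifPn; rewrite ?mul1e ?mul0e.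
Qed.

Let iota_gt0 n i : i \in index_iota 1 n.+1 -> (1 <= i)%N.
Proof. by rewrite mem_index_iota => /andP[]. Qed.

Let measurable_XX i : measurable_fun setT (X i : OX -> borel_rV R d).
Proof. exact: measurable_process_sigma. Qed.

Let S n x : set ((ON * OR) * OX) := [set z | N T z.1.1 = n /\
  x < exit_level A
    (\sum_(i <- index_iota 1 n.+1) theta i z.1 *: (X i z.2 : 'rV[R]_d))].

Let mS n x : measurable (S n x).
Proof.
have -> : S n x = (D n `*` setT) `*` setT `&` [set z | x < exit_level A
    (\sum_(i <- index_iota 1 n.+1) theta i z.1 *: (X i z.2 : 'rV[R]_d))].
  by apply/seteqP; split => -[[v w] u]; rewrite /S/D/=; tauto.
apply: measurableI; first by apply: measurableX => //; exact: measurableX.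
apply: (@measurable_weighted_exceeds _ _ R d A (fun i z => theta i z.1)
  (fun i (z : (ON * OR) * OX) => X i z.2 : borel_rV R d)) => i /iota_gt0 i1.
- by apply: measurableT_comp => //; exact: measurable_theta.
- by apply: measurableT_comp => //; exact: measurable_XX.
Qed.

Let E n x : set Omega := [set w | N T w = n /\ x < exit_level A
  (\sum_(i <- index_iota 1 n.+1) Theta (tau i w, w) *: (X i w : 'rV[R]_d))].

Let exceeds n x z := sum_exceeds A X (theta ^~ z) (index_iota 1 n.+1) x.

Let section_S n x z : muX (xsection (S n x) z) =
  ((\1_(D n) z.1)%:E * P (exceeds n x z))%E.
Proof.
rewrite indicE /D; have [zD|zD] := pselect (N T z.1 = n).
  rewrite mem_set// mul1e; congr (P _); apply/seteqP; split => u.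
    by rewrite /xsection/= inE => -[].
  by rewrite /xsection/= inE.
rewrite memNset// mul0e (_ : xsection _ _ = set0) ?measure0//.
by apply/seteqP; split => u //; rewrite /xsection/= inE => -[].
Qed.

Let E_integral n x :
  P (E n x) = (\int[muN \x muR]_z ((\1_(D n) z.1)%:E * P (exceeds n x z)))%E.
Proof.
transitivity (((muN \x muR) \x muX) (S n x))%E; first exact: (joint_law (mS n x)).
transitivity (\int[muN \x muR]_z muX (xsection (S n x) z))%E; first by [].
apply: eq_integral => z _; exact: section_S.
Qed.

Let measurable_section n x : measurable_fun setT
  (fun z => ((\1_(D n) z.1)%:E * P (exceeds n x z))%E).
Proof.
have := measurable_fun_xsection muX (mS n x).
by apply: eq_measurable_fun => z _; rewrite /= section_S.
Qed.

Let q n x (z : ON * OR) := \sum_(1 <= i < n.+1) tail V (x / theta i z).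

Let q_ge0 n x z : 0 <= q n x z.
Proof. by rewrite sumr_ge0// => i _; exact: tail_ge0. Qed.

Let measurable_1q n x :
  measurable_fun setT (fun z => ((\1_(D n) z.1)%:E * (q n x z)%:E)%E).
Proof.
apply: emeasurable_funM; apply/measurable_EFinP.
  have mi : measurable_fun setT (\1_(D n) : ON -> R) by exact: measurable_indic.
  exact: (measurableT_comp mi measurable_fst).
rewrite /q; under eq_fun do rewrite big_add1/= big_mkord.
apply: measurable_sum => i; apply/measurable_EFinP.
by apply: measurable_scaled_tail; [exact: measurable_theta|move=> z; exact: Theta_gt0].
Qed.

Let mexceeds n x z : measurable (exceeds n x z).
Proof. exact: measurable_sum_exceeds. Qed.

Let oneq_ge0 n x z : (0 <= (\1_(D n) z.1)%:E * (q n x z)%:E)%E.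
Proof. by rewrite mule_ge0// lee_fin. Qed.

Let J_scale n x (c : R) : 0 <= c -> (c%:E * J n x =
  \int[muN \x muR]_z (c%:E * ((\1_(D n) z.1)%:E * (q n x z)%:E)))%E.
Proof.
by move=> c0; rewrite /J ge0_integralZl_EFin.
Qed.

(** Bounds valid for fixed arrivals and returns are integrated; since they are
    linear in [q], only [J] remains. *)
Let E_le n x y (c1 c2 : R) : 0 <= c1 -> 0 <= c2 ->
  (forall z, fine (P (exceeds n x z)) <= c1 * q n y z + c2 * q n x z) ->
  (P (E n x) <= c1%:E * J n y + c2%:E * J n x)%E.
Proof.
move=> c10 c20 Hle; rewrite E_integral !J_scale//.
have mc c y' : measurable_fun setT
    (fun z => (c%:E * ((\1_(D n) z.1)%:E * (q n y' z)%:E))%E).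
  by apply: measurable_funeM; exact: measurable_1q.
rewrite -ge0_integralD//; try by move=> z _; rewrite mule_ge0 ?oneq_ge0.
have mD2 := emeasurable_funD (mc c1 y) (mc c2 x).
have mL := @measurable_section n x.
have L0 z : (0 <= (\1_(D n) z.1)%:E * P (exceeds n x z))%E.
  by rewrite mule_ge0// lee_fin.
apply: ge0_le_integral => // z _.
rewrite -(fine_probabilityK P (mexceeds n x z)) -!EFinM -EFinD lee_fin.
by rewrite mulrCA [c2 * _]mulrCA -mulrDr ler_wpM2l.
Qed.

Let E_ge n x (c : R) : 0 <= c ->
  (forall z, c * q n x z <= fine (P (exceeds n x z))) ->
  (c%:E * J n x <= P (E n x))%E.
Proof.
move=> c0 Hge; rewrite E_integral J_scale//.
have mc := measurable_funeM c%:E (@measurable_1q n x).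
have mL := @measurable_section n x.
have c1q z : (0 <= c%:E * ((\1_(D n) z.1)%:E * (q n x z)%:E))%E.
  by rewrite mule_ge0 ?oneq_ge0.
apply: ge0_le_integral => // z _; rewrite -(fine_probabilityK P (mexceeds n x z)) -!EFinM lee_fin.
by rewrite mulrCA ler_wpM2l.
Qed.

Let mE n x : measurable (E n x).
Proof.
have mdiag : measurable_fun setT (fun w : Omega => ((w : ON, w : OR), w : OX)).
  apply: measurable_fun_pair; last exact: (measurable_funP idX).
  by apply: measurable_fun_pair; [exact: (measurable_funP idN)|exact: (measurable_funP idR)].
by have := mdiag measurableT _ (mS n x); rewrite setTI.
Qed.

Let kappa n := lambda * poisson_pmf (lambda * T) n * T.

Let kappa_ge0 n : 0 <= kappa n.
Proof. by rewrite !mulr_ge0 ?poisson_pmf_ge0// ltW. Qed.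

Let Hr x := fine (H x).

Let HrE x : H x = (Hr x)%:E.
Proof. by rewrite /Hr fineK// mixed_tail_fin_num. Qed.

Let m_gt0 : (0 < m setT)%E.
Proof. by rewrite (_ : m setT = 1%E) ?lte_fin//; exact: probability_setT. Qed.

Let V_tail_gt0 y : 0 <= y -> 0 < tail V y.
Proof. exact: subexponential_tail_gt0. Qed.

Let Hr_gt0 x : 0 <= x -> 0 < Hr x.
Proof.
move=> x0; rewrite -lte_fin -HrE.
by apply: mixed_tail_gt0 => //; exact: Theta_gt0.
Qed.

Let pr n x := fine (P (E n.+1 x)).

Let prE n x : P (E n.+1 x) = (pr n x)%:E.
Proof. by rewrite /pr fine_probabilityK. Qed.

Let pr_geometric : exists2 r : R, 1 <= r & forall n x, 0 <= x ->
  pr n x <= r ^+ n.+1 * kappa n * Hr x.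
Proof.
have [r r1 rP] := sum_exceeds_geometric_bound X_distr X_indep F_subexp.
exists r => // n x x0; have r0 : 0 <= r by rewrite (le_trans ler01).
rewrite -lee_fin -prE (le_trans (@E_le n.+1 x x (r ^+ n.+1) 0 _ _ _))//.
- exact: exprn_ge0.
- move=> z; rewrite mul0r addr0.
  have := rP (theta ^~ z) (index_iota 1 n.+2) x (fun i => Theta_gt0 _) (iota_uniq _ _) x0.
  by rewrite size_iota subn1.
- by rewrite mul0e adde0 J_E HrE -!EFinM mulrA.
Qed.

(** The upper bound is asymptotically tight after integration, because the shift
    [h] is harmless for the long-tailed mixture [H]. *)
Let pr_cvg n : (fun x => pr n x / Hr x) @ +oo --> kappa n.
Proof.
apply/cvgrPdist_le => e e0.
(* Upper and lower bounds lose at most [2 * e1] times [kappa n]. *)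
pose e1 := e / (3 * (kappa n + 1)).
have k1 : 0 < kappa n + 1 by rewrite ltr_wpDl.
have e10 : 0 < e1 by rewrite divr_gt0// mulr_gt0.
have ke : kappa n * (2 * e1) <= e.
  have e1E : e1 * (3 * (kappa n + 1)) = e.
    by rewrite /e1 divfK// gt_eqF// mulr_gt0.
  have := mulr_ge0 (kappa_ge0 n) (ltW e10).
  by have := e10; have := e1E; lra.
have b0 : 0 < b by exact: expR_gt0.
have [h h0 [x1 x10 Hup]] :=
  sum_exceeds_le_sum X_distr X_indep F_subexp n.+1 b0 e10.
have := mixed_tail_long_tailed measurable_Theta Theta_gt0 Theta_le m_gt0 F_subexp h0 e10.
move=> /near_pinftyP[x2 x20 Hlong].
have e1n : 0 < e1 / n.+1%:R by rewrite divr_gt0.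
have /cvgrPdist_le/(_ _ e1n)/near_pinftyP[y3 y30 Hsmall] := tail_cvg0 V.
apply/near_pinftyP; exists (x1 + x2 + y3 * b).
  by rewrite !addr_gt0// mulr_gt0.
move=> x xx; have yb0 : 0 < y3 * b by rewrite mulr_gt0.
have xx1 : x1 <= x by lra.
have xx2 : x2 <= x by lra.
have xx3 : y3 * b <= x by lra.
have x0 : 0 <= x by lra.
have Hx := Hr_gt0 x0.
have up : pr n x <= kappa n * Hr (x - h) + e1 * (kappa n * Hr x).
  rewrite -lee_fin -prE (le_trans (@E_le n.+1 x (x - h) 1 e1 _ _ _))//.
  - exact: ltW.
  - move=> z; rewrite mul1r.
    apply: (Hup (theta ^~ z) (index_iota 1 n.+2) x) => //.
    + by move=> i; exact: Theta_gt0.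
    + by move=> i; exact: Theta_le.
    + exact: iota_uniq.
    + by rewrite size_iota subn1.
  - by rewrite mul1e !J_E !HrE -!EFinM -EFinD.
have long : Hr (x - h) <= (1 + e1) * Hr x.
  by have := Hlong x xx2; rewrite -/(H _) -/(H x) !HrE -EFinM lee_fin.
have small : n.+1%:R * tail V (x / b) <= e1.
  have := Hsmall (x / b); rewrite ler_pdivlMr// => /(_ xx3).
  by rewrite sub0r normrN ger0_norm ?tail_ge0// ler_pdivlMr// mulrC.
have low : (1 - e1) * (kappa n * Hr x) <= pr n x.
  have c0 : 0 <= Num.max 0 (1 - e1) by rewrite le_max lexx.
  apply: (@le_trans _ _ (Num.max 0 (1 - e1) * (kappa n * Hr x))).
    apply: ler_wpM2r; first by rewrite mulr_ge0// ltW.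
    by rewrite le_max lexx orbT.
  rewrite -lee_fin -prE (le_trans _ (@E_ge n.+1 x _ c0 _))//.
    by rewrite J_E HrE -!EFinM.
  move=> z; have [le1|le1] := leP (1 - e1) 0; first by rewrite mul0r fine_probability_ge0.
  have t0 i : 0 < theta i z by exact: Theta_gt0.
  have tb i : theta i z <= b by exact: Theta_le.
  have := sum_exceeds_ge A X_ge0 X_distr X_indep t0 tb (iota_uniq 1 n.+1) x0.
  rewrite size_iota; apply: le_trans; rewrite /q /index_iota subSS subn0.
  by rewrite ler_wpM2r ?lerB// sumr_ge0// => i _; exact: tail_ge0.
have Hk : 0 <= kappa n * Hr x by rewrite mulr_ge0// ltW.
have Hke : kappa n * (2 * e1) * Hr x <= e * Hr x by rewrite ler_wpM2r// ltW.
have Hke0 : 0 <= e1 * (kappa n * Hr x) by rewrite mulr_ge0// ltW.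
have Hl : kappa n * Hr (x - h) <= kappa n * ((1 + e1) * Hr x) by rewrite ler_wpM2l.
rewrite ler_distlC ler_pdivlMr// ler_pdivrMr//; apply/andP; split.
  by move: low Hke Hke0; lra.
by move: up Hl Hke; lra.
Qed.

Let f x := fine (P [set w | x < exit_level A
  (\sum_(1 <= i < (N T w).+1) Theta (tau i w, w) *: (X i w : 'rV[R]_d))]).

Let f_series x : 0 <= x -> series (fun n => pr n x) @ \oo --> f x.
Proof.
move=> x0.
have EU : \bigcup_n E n.+1 x = [set w | x < exit_level A
    (\sum_(1 <= i < (N T w).+1) Theta (tau i w, w) *: (X i w : 'rV[R]_d))].
  apply/seteqP; split => w /=; first by move=> [n _ [<-]].
  case Nw : (N T w) => [|n]; last by exists n.
  by rewrite big_geq// exit_level0 ltNge x0.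
have tE : trivIset setT (fun n => E n.+1 x).
  apply/trivIsetP => i j _ _ /eqP ij; apply/seteqP; split => // w [[Ni _] [Nj _]].
  by apply: ij; apply: succn_inj; rewrite -Ni -Nj.
have mU : measurable (\bigcup_n E n.+1 x) by apply: bigcup_measurable.
have := @measure_semi_sigma_additive _ _ _ P (fun n => E n.+1 x) (fun n => mE n.+1 x) tE mU.
have PE : P (\bigcup_n E n.+1 x) = (f x)%:E by rewrite /f -EU fine_probabilityK.
rewrite [X in _ --> X](_ : _ = (f x)%:E); last exact: PE.
rewrite (_ : (fun k => _) = EFin \o series (fun n => pr n x)).
  by move=> /fine_cvg.
apply/funext => k; rewrite /series/= -sumEFin; apply: eq_bigr => i _.
exact: prE.
Qed.

(** The terms are dominated by [r ^+ n.+1 * kappa n], summable because Poisson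
    weights beat every geometric sequence, and the weights [poisson_pmf] add up
    to 1. *)
Let f_ratio : (fun x => f x / Hr x) @ +oo --> lambda * T.
Proof.
have [r r1 rP] := pr_geometric; have r0 : 0 < r by rewrite (lt_le_trans ltr01).
have x0near : \forall x \near +oo, (0 : R) <= x by apply: nbhs_pinfty_ge; exact: num_real.
apply: (tannery (a := fun n x => pr n x / Hr x) (c := kappa)
  (u := fun n => r ^+ n.+1 * kappa n)).
- near=> x; move=> n; have x0 : 0 <= x by near: x.
  rewrite divr_ge0 ?fine_probability_ge0 ?(ltW (Hr_gt0 x0))//=.
  by rewrite ler_pdivrMr ?Hr_gt0// rP.
- exact: pr_cvg.
- near=> x; have x0 : 0 <= x by near: x.
  have -> : series (fun n => pr n x / Hr x) = fun n => series (fun n => pr n x) n / Hr x.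
    by apply/funext => n; rewrite /series/= mulr_suml.
  by apply: cvgM; [exact: f_series|exact: cvg_cst].
- have -> : series (fun n => r ^+ n.+1 * kappa n) =
      fun n => (r * lambda * T) * series (fun n => r ^+ n * poisson_pmf (lambda * T) n) n.
    apply/funext => n; rewrite /series/= mulr_sumr; apply: eq_bigr => i _.
    by rewrite exprS /kappa; ring.
  apply: is_cvgM; first exact: is_cvg_cst.
  by apply: poisson_pmf_geometric_series => //; rewrite mulr_gt0.
- have -> : series kappa = fun n => (lambda * T) * series (poisson_pmf (lambda * T)) n.
    apply/funext => n; rewrite /series/= mulr_sumr; apply: eq_bigr => i _.
    by rewrite /kappa mulrAC.
  rewrite -[X in _ --> X]mulr1; apply: cvgM; first exact: cvg_cst.
  by apply: poisson_pmf_series; rewrite mulr_gt0.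
Unshelve. all: by end_near. Qed.

Let measurable_sum_arrivals (W : R * OR -> R) x : measurable_fun setT W ->
  measurable [set w | x < exit_level A
    (\sum_(1 <= i < (N T w).+1) W (tau i w, w) *: (X i w : 'rV[R]_d))].
Proof.
move=> mW; have -> : [set w | x < exit_level A
    (\sum_(1 <= i < (N T w).+1) W (tau i w, w) *: (X i w : 'rV[R]_d))] =
  \bigcup_n ([set w | N T w = n] `&` [set w | x < exit_level A
    (\sum_(i <- index_iota 1 n.+1) W (tau i w, w) *: (X i w : 'rV[R]_d))]).
  apply/seteqP; split => w /=; first by exists (N T w).
  by move=> [n _ [/= <-]].
apply: bigcup_measurable => n _; apply: measurableI.
  have mN : measurable_fun setT (N T) by exact: measurable_funP.
  by have := mN measurableT [set n] I; rewrite setTI.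
apply: (@measurable_weighted_exceeds _ _ R d A (fun i w => W (tau i w, w)) X).
- move=> i /iota_gt0 i1; apply: (measurableT_comp mW).
  apply: measurable_fun_pair; last exact: (measurable_funP idR).
  by apply: (measurable_arrival N_tau) => // t _; exact: measurable_funP.
- by move=> i _; exact: measurable_funP.
Qed.

Let numerator x : 0 < x ->
  P [set w | scale_set x A (discounted_claims X N tau Rt T w)] = (f x)%:E.
Proof.
move=> x0; rewrite /f fine_probabilityK; last first.
  exact: measurable_sum_arrivals.
pose W (p : R * OR) := expR (- Rt (Num.max p.1 0) p.2).
have mW : measurable_fun setT W.
  by apply: measurableT_comp => //; exact: measurableT_comp.
have DE w : discounted_claims X N tau Rt T w =
    \sum_(1 <= i < (N T w).+1) W (tau i w, w) *: (X i w : 'rV[R]_d).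
  rewrite /discounted_claims big_nat [RHS]big_nat.
  apply: eq_bigr => i /andP[i1 _].
  by rewrite /W/= max_l// ltW// (arrival_gt0 N_tau).
have -> : [set w | scale_set x A (discounted_claims X N tau Rt T w)] =
    [set w | x < exit_level A
      (\sum_(1 <= i < (N T w).+1) W (tau i w, w) *: (X i w : 'rV[R]_d))].
  by apply/funext => w; apply/propext; rewrite /mkset exit_level_gtP// DE.
apply: (eq_probability_off_null _ _ Rt_gt).
- exact: measurable_sum_arrivals.
- exact: measurable_sum_arrivals.
move=> w Hw /=; rewrite big_nat [X in _ <-> _ < exit_level _ X]big_nat.
rewrite (eq_bigr (fun i => Theta (tau i w, w) *: (X i w : 'rV[R]_d)))// => i.
rewrite ltnS => /andP[i1 iN].
have t0 : 0 <= tau i w by rewrite ltW// (arrival_gt0 N_tau).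
rewrite /W/= max_l// Theta_eq// (arrival_leP N_tau)//; exact: ltW.
Qed.

Let single_claim t x : 0 <= t -> t <= T -> 0 < x ->
  P [set w | scale_set x A (expR (- Rt t w) *: (X 0%N w : 'rV[R]_d))] = G x t.
Proof.
move=> t0 tT x0.
pose S1 : set ((ON * OR) * OX) := [set z | x < exit_level A
  (Theta (t, z.1.2) *: (X 0%N z.2 : 'rV[R]_d))].
have mTt : measurable_fun setT (fun w : OR => Theta (t, w)).
  by apply: (measurableT_comp measurable_Theta); exact: measurable_fun_pair.
have mS1 : measurable S1.
  have := @measurable_weighted_exceeds _ _ R d A
    (fun (_ : nat) (z : (ON * OR) * OX) => Theta (t, z.1.2))
    (fun i (z : (ON * OR) * OX) => X i z.2 : borel_rV R d) [:: 0%N] x.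
  under eq_set do rewrite big_seq1; apply.
  - move=> i _; apply: (measurableT_comp mTt).
    by apply: measurableT_comp => //; exact: measurable_snd.
  - by move=> i _; apply: measurableT_comp => //; exact: measurable_XX.
have mdiag : measurable_fun setT (fun w : Omega => ((w : ON, w : OR), w : OX)).
  apply: measurable_fun_pair; last exact: (measurable_funP idX).
  by apply: measurable_fun_pair; [exact: (measurable_funP idN)|exact: (measurable_funP idR)].
transitivity (P [set w | S1 ((w, w), w)]).
  have -> : [set w | scale_set x A (expR (- Rt t w) *: (X 0%N w : 'rV[R]_d))] =
      [set w | x < exit_level A (expR (- Rt t w) *: (X 0%N w : 'rV[R]_d))].
    by apply/funext => w; apply/propext; rewrite /mkset exit_level_gtP.
  apply: (eq_probability_off_null _ _ Rt_gt).
  - have := @measurable_weighted_exceeds _ _ R d A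
      (fun (_ : nat) w => expR (- Rt t w)) X [:: 0%N] x.
    under eq_set do rewrite big_seq1; apply.
      move=> i _; apply: measurableT_comp => //; exact: measurableT_comp.
    by move=> i _; exact: measurable_funP.
  - by have := mdiag measurableT _ mS1; rewrite setTI.
  by move=> w Hw; rewrite /S1/= Theta_eq.
transitivity (((muN \x muR) \x muX) S1)%E; first exact: (joint_law mS1).
transitivity (\int[muN \x muR]_z muX (xsection S1 z))%E; first by [].
transitivity (\int[muN \x muR]_z (tail V (x / Theta (t, z.2)))%:E)%E.
  apply: eq_integral => z _; rewrite -tailE.
  have mY := measurable_exit_level A measurableT
    (measurable_itv `]x / Theta (t, z.2), +oo[).
  rewrite setTI in mY; apply: etrans (X_distr 0 mY); congr (P _).
  by apply/seteqP; split => u; rewrite /xsection/S1/= inE/= in_itv/= andbT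
    exit_levelZ// ltr_pdivrMr// mulrC.
rewrite fubini_tonelli1//; last 2 first.
- apply/measurable_EFinP.
  have mTz : measurable_fun setT (fun z : ON * OR => Theta (t, z.2)).
    by apply: (measurableT_comp mTt); exact: measurable_snd.
  have := @measurable_scaled_tail _ V _ _ _ mTz (fun z => Theta_gt0 _) x.
  by move=> /measurable_EFinP.
- by move=> z; rewrite lee_fin tail_ge0.
transitivity (\int[muN]_v (cst (G x t) v))%E; first by [].
rewrite integral_cst//.
by rewrite [X in (_ * X)%E](_ : _ = 1%E) ?mule1//; exact: probability_setT.
Qed.

Lemma compound_claims_asymptotics : (fun x : R =>
   fine (P [set w | scale_set x A (discounted_claims X N tau Rt T w)]) /
   (lambda * fine (\int[lebesgue_measure]_(t in `[0%R, T]%classic)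
      P [set w | scale_set x A (expR (- Rt t w) *: (X 0%N w : 'rV[R]_d))])))
  @ +oo --> (1 : R).
Proof.
have lT0 : lambda * T != 0 by rewrite mulf_neq0// gt_eqF.
have : (fun x => f x / Hr x * (lambda * T)^-1) @ +oo --> (1 : R).
  rewrite -(divff lT0); apply: cvgM; [exact: f_ratio|exact: cvg_cst].
apply: cvg_trans; apply: near_eq_cvg; near=> x.
have x0 : 0 < x by near: x; apply: nbhs_pinfty_gt; exact: num_real.
rewrite numerator//= (_ : (\int[_]_(t in _) _)%E = (T * Hr x)%:E); last first.
  rewrite EFinM -HrE -integral_G; apply: eq_integral => t.
  by rewrite inE/= in_itv/= => /andP[t0 tT]; rewrite single_claim.
have Hx := Hr_gt0 (ltW x0).
rewrite /= -mulrA; congr (_ * _); rewrite -invfM; congr (_^-1).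
by ring.
Unshelve. all: by end_near. Qed.

End compound_process.

Theorem theorem5p1 (R : realType) (d : nat) (hd : (1 <= d)%N)
  (A : rare_set R d)
  (disp : measure_display) (Omega : measurableType disp)
  (P : probability Omega R)
  (F : probability (borel_rV R d) R)
  (X : nat -> {RV P >-> borel_rV R d})
  (X_ge0 : forall i w, nneg_rV (X i w))
  (X_distr : forall i B, measurable B -> distribution P (X i) B = F B)
  (X_indep : mutual_independence P (fun i => g_sigma_algebra_preimage (X i)))
  (F_subexp : subexponential_on A F)
  (lambda : R) (lambda_gt0 : 0 < lambda)
  (N : R -> {RV P >-> nat}) (N_poisson : poisson_process lambda N)
  (tau : nat -> Omega -> R) (N_tau : arrival_times N tau)
  (Rt : R -> {RV P >-> R}) (Rt_meas : jointly_measurable P Rt)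
  (XNR_indep : mutual_independence P (fun k : 'I_3 => nth set0
     [:: process_sigma setT X;
         process_sigma `[0, +oo[%classic N;
         process_sigma `[0, +oo[%classic (fun t w => expR (Rt t w))] k))
  (T : R) (T_gt0 : 0 < T)
  (Rt_bounded : exists C : R, {ae P, forall w,
     ((- C)%:E < ereal_inf [set (Rt t w)%:E | t in `[0%R, T]%classic])%E}) :
  (fun x : R =>
     fine (P [set w | scale_set x A (discounted_claims X N tau Rt T w)]) /
     (lambda * fine (\int[lebesgue_measure]_(t in `[0%R, T]%classic)
        P [set w | scale_set x A (expR (- Rt t w) *: (X 0%N w : 'rV[R]_d))])))
    @ +oo --> (1 : R).
Proof.
have [C RtC] := Rt_bounded.
apply: (compound_claims_asymptotics X_ge0 X_distr X_indep F_subexp lambda_gt0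
  N_poisson N_tau Rt_meas XNR_indep T_gt0 (C := C)).
case: RtC => Z [mZ PZ H]; exists Z; split => // w /= nH; apply: H => /= H.
apply: nH => t t0 tT; rewrite -lte_fin (lt_le_trans H)//.
by apply: ereal_inf_lbound; exists t => //=; rewrite in_itv/= t0.
Qed.
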